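(* Let $q$ be a power of $3$. The generic lines of $PG(3,q)$ decompose into $G$-orbits as follows: for each $i\in\{1,2,4\}$ and each $r\in J_i$, there are exactly $i$ $G$-orbits of generic lines $L$ with $\jmath(f_L)=r$, each of size $|G|/i$, and every $G$-orbit of generic lines arises in this way. Consequently, the number of $G$-orbits of generic lines is $2q-3$, of which $q/3$ have size $|G|$, $q-1$ have size $|G|/2$, and $(2q-6)/3$ have size $|G|/4$.
   Context: Points of $PG(3,q)$ are written $(y_0:y_1:y_2:y_3)$. The twisted cubic is $C=\{\nu(s,t)=(s^3:s^2t:st^2:t^3):(s:t)\in PG(1,q)\}$; for a field $K\supseteq\mathbb{F}_q$, $C(K)$ denotes the analogous set of points with $(s:t)\in\mathbb{P}^1(K)$. $G=PGL_2(q)$, $|G|=q^3-q$, acts on $PG(3,q)$ by letting $g=\begin{pmatrix} a&b\\ c&d\end{pmatrix}$ act on column vectors $(y_0,y_1,y_2,y_3)^T$ by the matrix $\begin{pmatrix} a^3&0&0&b^3\\ a^2c&a(ad-bc)&-b(ad-bc)&b^2d\\ ac^2&-c(ad-bc)&d(ad-bc)&bd^2\\ c^3&0&0&d^3\end{pmatrix}$, so that $\nu(as+bt,cs+dt)$ is the image of $\nu(s,t)$. The osculating plane of $C$ at $\nu(s,t)$ is $t^3y_0-s^3y_3=0$ (characteristic $3$). A line of $PG(3,q)$ is generic if it does not meet $C(\overline{\mathbb{F}_q})$ and is not contained in any osculating plane of $C$. If $L$ is the line through distinct points $x,y$, its Plücker coordinates are $p_{ij}=x_iy_j-x_jy_i$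 ($0\le i<j\le3$), defined up to a common scalar, and its associated binary quartic form is $f_L=p_{23}X^4+p_{13}X^3Y+p_{03}X^2Y^2+p_{02}XY^3+p_{01}Y^4$. For a binary quartic form $f=z_0X^4+z_1X^3Y+z_2X^2Y^2+z_3XY^3+z_4Y^4$, $\Delta(f)=(z_0z_4-z_1z_3)^3+(z_0z_4-z_1z_3)^2z_2^2-z_2^3(z_0z_3^2+z_4z_1^2-z_0z_2z_4)$ and, when $\Delta(f)\ne0$, $\jmath(f)=z_2^6/\Delta(f)$ (for generic $L$ one has $\Delta(f_L)\neq 0$). $J_2$ is the set of non-squares of $\mathbb{F}_q^\times$; $J_4$ (resp. $J_1$) is the set of nonzero squares $r$ with $\mathrm{Tr}_{\mathbb{F}_q/\mathbb{F}_3}(1/\sqrt r)=0$ (resp. $\neq0$). *)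

(* Defs.v *)
From HB Require Import structures.
From mathcomp Require Import all_boot all_order all_algebra all_fingroup.
From mathcomp Require Import all_solvable all_field.
From mathcomp Require Import boolp ring.

Set Implicit Arguments.
Unset Strict Implicit.
Unset Printing Implicit Defensive.

Import GRing.Theory.
Local Open Scope ring_scope.

(* nu s t = (s^3, s^2 t, s t^2, t^3)^T, homogeneous coordinates of a point of
   the twisted cubic when (s, t) <> (0, 0). *)
Definition nu (R : comNzRingType) (s t : R) : 'cV[R]_4 :=
  \col_(i < 4) (s ^+ (3 - i) * t ^+ i).

Section Lines.
Variable F : finFieldType.

(* Projective subspaces are identified with linear subspaces of F^4, given by
   their finite sets of vectors. *)
Definition line (x y : 'cV[F]_4) : {set 'cV[F]_4} :=
  [set v | v \in <<[:: x; y]>>%VS].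

(* x and y represent distinct points iff they are linearly independent. *)
Definition is_line (L : {set 'cV[F]_4}) : bool :=
  [exists x : 'cV[F]_4, exists y : 'cV[F]_4,
     free [:: x; y] && (L == line x y)].

Definition osculating_plane (s t : F) : {set 'cV[F]_4} :=
  [set y : 'cV[F]_4 | t ^+ 3 * y 0 0 - s ^+ 3 * y 3 0 == 0].

Definition in_osculating_plane (L : {set 'cV[F]_4}) : bool :=
  [exists s : F, exists t : F,
     ((s, t) != (0, 0)) && (L \subset osculating_plane s t)].

Definition extend_line (K : fieldType) (FtoK : F -> K) (L : {set 'cV[F]_4}) :
    {vspace 'cV[K]_4} :=
  <<[seq map_mx FtoK v | v <- enum L]>>%VS.

Definition meets_cubic (K : fieldType) (FtoK : F -> K)
    (L : {set 'cV[F]_4}) : Prop :=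
  exists s t : K, (s, t) != (0, 0) /\ nu s t \in extend_line FtoK L.

(* To be used with FtoK : F -> K the embedding of F in an algebraic closure. *)
Definition generic (K : fieldType) (FtoK : F -> K)
    (L : {set 'cV[F]_4}) : Prop :=
  [/\ is_line L, ~ meets_cubic FtoK L & ~~ in_osculating_plane L].

Definition generic_lines (K : fieldType) (FtoK : F -> K) :
    {set {set 'cV[F]_4}} :=
  [set L | `[< generic FtoK L >]].

(* z_0 X^4 + z_1 X^3 Y + z_2 X^2 Y^2 + z_3 X Y^3 + z_4 Y^4 *)
Record quartic := Quartic { z0 : F; z1 : F; z2 : F; z3 : F; z4 : F }.

Definition plucker (x y : 'cV[F]_4) (i j : 'I_4) : F :=
  x i 0 * y j 0 - x j 0 * y i 0.

Definition line_quartic (x y : 'cV[F]_4) : quartic :=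
  let p := plucker x y in Quartic (p 2 3) (p 1 3) (p 0 3) (p 0 2) (p 0 1).

Definition Delta (f : quartic) : F :=
  let: Quartic z0 z1 z2 z3 z4 := f in
  (z0 * z4 - z1 * z3) ^+ 3 + (z0 * z4 - z1 * z3) ^+ 2 * z2 ^+ 2
  - z2 ^+ 3 * (z0 * z3 ^+ 2 + z4 * z1 ^+ 2 - z0 * z2 * z4).

Definition jinv (f : quartic) : F := z2 f ^+ 6 / Delta f.

(* The quartic of L is only defined up to a nonzero scalar, which leaves
   jinv unchanged because Delta is homogeneous of degree 6. *)
Definition has_jinv (L : {set 'cV[F]_4}) (r : F) : bool :=
  [exists x : 'cV[F]_4, exists y : 'cV[F]_4,
     [&& free [:: x; y], L == line x y,
         Delta (line_quartic x y) != 0 & jinv (line_quartic x y) == r]].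

Definition PGL2 := ('GL_2[F] / 'Z('GL_2[F]))%G.

Definition cubic_mx (m : 'M[F]_2) : 'M[F]_4 :=
  let a := m 0 0 in let b := m 0 1 in
  let c := m 1 0 in let d := m 1 1 in
  let e := a * d - b * c in
  \matrix_(i < 4, j < 4) nth 0 (nth [::]
    [:: [:: a ^+ 3;     0;          0;          b ^+ 3];
        [:: a ^+ 2 * c; a * e;      - (b * e);  b ^+ 2 * d];
        [:: a * c ^+ 2; - (c * e);  d * e;      b * d ^+ 2];
        [:: c ^+ 3;     0;          0;          d ^+ 3]] i) j.

Definition cubic_act (m : 'M[F]_2) (L : {set 'cV[F]_4}) : {set 'cV[F]_4} :=
  [set cubic_mx m *m v | v in L].

(* The choice of the representative of the class g is irrelevant on lines,
   see pgl_act_coset below. *)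
Definition pgl_act (g : coset_of 'Z('GL_2[F])) (L : {set 'cV[F]_4}) :
    {set 'cV[F]_4} :=
  cubic_act (GLval (repr g)) L.

Definition line_orbit (L : {set 'cV[F]_4}) : {set {set 'cV[F]_4}} :=
  [set pgl_act g L | g in PGL2].

Definition generic_orbits (K : fieldType) (FtoK : F -> K) :
    {set {set {set 'cV[F]_4}}} :=
  [set line_orbit L | L in generic_lines FtoK].

Definition generic_orbits_jinv (K : fieldType) (FtoK : F -> K) (r : F) :
    {set {set {set 'cV[F]_4}}} :=
  [set line_orbit L | L in generic_lines FtoK & has_jinv L r].

Lemma cubic_mxZ (k : F) (m : 'M[F]_2) :
  cubic_mx (k *: m) = k ^+ 3 *: cubic_mx m.
Proof.
by apply/matrixP=> [[[|[|[|[|i]]]] Hi]] [[|[|[|[|j]]]] Hj] //;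
  rewrite !mxE /=; ring.
Qed.

Lemma cubic_mx_nu (m : 'M[F]_2) (s t : F) : 3%N \in [pchar F] ->
  cubic_mx m *m nu s t = nu (m 0 0 * s + m 0 1 * t) (m 1 0 * s + m 1 1 * t).
Proof.
move=> char3; have tri : 3%:R = 0 :> F := pcharf0 char3.
have eq3 (x y z : F) : x = y + 3%:R * z -> x = y by rewrite tri mul0r addr0.
apply/matrixP=> [[[|[|[|[|i]]]] Hi]] j //;
  rewrite !mxE !big_ord_recl big_ord0 !mxE /=;
  set a := m 0 0; set b := m 0 1; set c := m 1 0; set d := m 1 1.
- by apply: (eq3 _ _ (- (a ^+ 2 * b * s ^+ 2 * t + a * b ^+ 2 * s * t ^+ 2)));
    rewrite /bump /=; ring.
- by apply: (eq3 _ _ (- (a * b * c * s ^+ 2 * t + a * b * d * s * t ^+ 2)));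
    rewrite /bump /=; ring.
- by apply: (eq3 _ _ (- (a * c * d * s ^+ 2 * t + b * c * d * s * t ^+ 2)));
    rewrite /bump /=; ring.
- by apply: (eq3 _ _ (- (c ^+ 2 * d * s ^+ 2 * t + c * d ^+ 2 * s * t ^+ 2)));
    rewrite /bump /=; ring.
Qed.

Lemma cubic_actZ (k : F) (m : 'M[F]_2) (U : {vspace 'cV[F]_4}) : k != 0 ->
  cubic_act (k *: m) [set v in U] = cubic_act m [set v in U].
Proof.
move=> k0; apply/setP=> w; apply/imsetP/imsetP=> -[v]; rewrite inE => vU ->.
  by exists (k ^+ 3 *: v); rewrite ?inE ?memvZ // cubic_mxZ -scalemxAl scalemxAr.
exists (k ^- 3 *: v); rewrite ?inE ?memvZ // cubic_mxZ -scalemxAl -scalemxAr.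
by rewrite scalerA mulfV ?scale1r // expf_neq0.
Qed.

Lemma GL2_center (z : {'GL_2[F]}) : z \in 'Z('GL_2[F])%g ->
  exists2 k : F, k != 0 & GLval z = k%:M.
Proof.
case/centerP=> _ zC.
have C (m : 'M[F]_2) : \det m = 1 -> GLval z *m m = m *m GLval z.
  move=> dm; have mU : m \in unitmx by rewrite unitmxE dm unitr1.
  by have := congr1 val (zC (FinRing.unit 'M_(2.-1.+1) mU) (in_setT _)).
pose E (b c : F) : 'M[F]_2 := \matrix_(i < 2, j < 2)
   (if i == 0 then if j == 0 then 1 else b else if j == 0 then c else 1).
have dE b c : b * c = 0 -> \det (E b c) = 1.
  move=> bc; rewrite (expand_det_row _ 0) big_ord_recl big_ord1 /cofactor.
  rewrite !det_mx11 !mxE /=.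
  by rewrite -[RHS](subr0 1) -bc; ring.
pose x := GLval z.
have H1 := C _ (dE 1 0 (mulr0 _)); have H2 := C _ (dE 0 1 (mul0r _)).
have /= := congr1 (fun A : 'M_2 => A 0 0) H1.
have /= := congr1 (fun A : 'M_2 => A 0 1) H1.
have /= := congr1 (fun A : 'M_2 => A 0 0) H2.
rewrite !mxE !big_ord_recl !big_ord0 !mxE /=.
have -> : lift ord0 ord0 = 1 :> 'I_2 by apply/val_inj.
have -> : ord0 = 0 :> 'I_2 by apply/val_inj.
rewrite -/x !(mul0r, mul1r, mulr0, mulr1, addr0, add0r) => e1 e2 e3.
have x01 : x 0 1 = 0 by apply: (addrI (x 0 0)); rewrite addr0.
have x10 : x 1 0 = 0 by apply: (addrI (x 0 0)); rewrite addr0.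
have x11 : x 1 1 = x 0 0 by apply: (addrI (x 0 1)); rewrite -e2 addrC.
have Dx : x = (x 0 0)%:M.
  apply/matrixP=> [[[|[|i]] Hi]] [[|[|j]] Hj] //; rewrite !mxE /=.
  - by congr (x _ _); apply: val_inj.
  - by rewrite mulr0n -[RHS]x01; congr (x _ _); apply: val_inj.
  - by rewrite mulr0n -[RHS]x10; congr (x _ _); apply: val_inj.
  - by rewrite mulr1n -[RHS]x11; congr (x _ _); apply: val_inj.
exists (x 0 0) => //; apply/eqP=> x0.
have : x \in unitmx by exact: (valP z).
by rewrite Dx x0 unitmxE det_scalar expr0n /= unitr0.
Qed.

Lemma pgl_act_coset (g : {'GL_2[F]}) (L : {set 'cV[F]_4}) :
  is_line L -> pgl_act (coset 'Z('GL_2[F]) g) L = cubic_act (GLval g) L.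
Proof.
case/existsP=> x /existsP[y /andP[_ /eqP->]]; rewrite /pgl_act /line.
have gN : g \in 'N('Z('GL_2[F]))%g.
  by rewrite (subsetP (normal_norm (center_normal _))) // inE.
have : repr (coset 'Z('GL_2[F]) g) \in (coset 'Z('GL_2[F]) g : {set _}).
  exact: mem_repr_coset.
rewrite val_coset // => /rcosetP[z /GL2_center[k k0 Dz] ->].
have -> : GLval (z * g)%g = k *: GLval g.
  by rewrite GL_ME Dz -mul_scalar_mx.
by rewrite cubic_actZ.
Qed.

End Lines.

Lemma pchar3 (F : finFieldType) (q n : nat) :
  q = (3 ^ n)%N -> #|F| = q -> 3%N \in [pchar F].
Proof. by move=> -> cardF; apply: (card_finPcharP cardF). Qed.

Section Trace.
Variables (F : finFieldType) (char3 : 3%N \in [pchar F]).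

(* The trace from F to its prime subfield, as an element of F;
   pPrimeCharType char3 is F viewed as an extension of 'F_3. *)
Definition trace3 (x : F) : F :=
  galTrace 1%AS {: pPrimeCharType char3}%AS x.

Definition J2 : {set F} := [set r | (r != 0) && ~~ [exists w, w ^+ 2 == r]].

Definition J4 : {set F} :=
  [set r | (r != 0) && [exists w, (w ^+ 2 == r) && (trace3 (w^-1) == 0)]].

Definition J1 : {set F} :=
  [set r | (r != 0) && [exists w, (w ^+ 2 == r) && (trace3 (w^-1) != 0)]].

Definition J (i : nat) : {set F} :=
  match i with 1 => J1 | 2 => J2 | 4 => J4 | _ => set0 end.

End Trace.

(* Main.v *)
Require Import Defs.
From HB Require Import structures.
From mathcomp Require Import all_boot all_order all_algebra all_fingroup.
From mathcomp Require Import all_solvable all_field.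
From mathcomp Require Import boolp ring zify.

Set Implicit Arguments.
Unset Strict Implicit.
Unset Printing Implicit Defensive.

Import GRing.Theory.
Local Open Scope ring_scope.

(* A line in no osculating plane has p_03 <> 0, hence is the graph of a linear
   map (y_0, y_3) |-> (y_1, y_2); its matrix gives the normalised coefficients
   z_0, z_1, z_3, z_4 (with z_2 = 1), and it misses the cubic iff Delta <> 0, in
   which case its invariant is 1 / Delta. So the lines with invariant r
   correspond to the solutions of Delta(z) = 1/r, of which there are q^3 - q,
   i.e. |G|. A line with z_1 = 0 and z_0 <> 0 can be found in every orbit, and
   its stabilizer consists of 1 and of one involution for each root in F_q of
   T^3 - r T + r. This polynomial has one root if r is not a square; if
   r = w^2, setting T = w M turns it into the Artin-Schreier equation
   M^3 - M = -1/w, which has three roots or none according to the trace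
   of 1/w. *)

(** Orbits are counted by division, not by listing representatives: the order of the stabilizer
    depends only on r, so the |G| lines with invariant r split into orbits of equal size. It then
    suffices to compute the stabilizer at one normal form per orbit, where z_1 = 0 reduces the
    discriminant to u (u - 1)^2 - z_0 z_3^2 with u = z_0 z_4. The stabilizer equations lead there to
    a cubic in B = 1 + z_0 b whose coefficients still involve z_0, z_3, z_4; the substitution B = 1
    - u - 1/T turns it into T^3 - r T + r, in which only r is left. Osculating planes have the form
    t^3 y_0 = s^3 y_3, and cubing is bijective on [F], so every plane t y_0 = s y_3 over [F] is
    osculating; this makes p_03 <> 0 the exact condition. The trace criterion is the additive
    Hilbert 90, obtained by comparing cardinalities. *)

Lemma mul3_eq0 (R : comNzRingType) (k : nat) :
  3%:R = 0 :> R -> (3 * k)%:R = 0 :> R.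
Proof. by rewrite natrM => ->; rewrite mul0r. Qed.

Lemma opp_mul3_eq0 (R : comNzRingType) (k : nat) :
  3%:R = 0 :> R -> - (3 * k)%:R = 0 :> R.
Proof. by rewrite natrM => ->; rewrite mul0r oppr0. Qed.

(* ring: only cancels coefficients equal to one of the listed ones, so the small
   multiples of 3 are listed explicitly. *)
Ltac char3_with tac H :=
  let R := lazymatch type of H with @eq ?R _ _ => R end in
  let P2 := fresh in let P3 := fresh in let P4 := fresh in
  let P5 := fresh in let P6 := fresh in let P7 := fresh in
  let P8 := fresh in
  let N1 := fresh in let N2 := fresh in let N3 := fresh in
  let N4 := fresh in let N5 := fresh in let N6 := fresh in
  let N7 := fresh in let N8 := fresh in
  have P2 : 6%:R = 0 :> R by [exact: (@mul3_eq0 _ 2 H)];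
  have P3 : 9%:R = 0 :> R by [exact: (@mul3_eq0 _ 3 H)];
  have P4 : 12%:R = 0 :> R by [exact: (@mul3_eq0 _ 4 H)];
  have P5 : 15%:R = 0 :> R by [exact: (@mul3_eq0 _ 5 H)];
  have P6 : 18%:R = 0 :> R by [exact: (@mul3_eq0 _ 6 H)];
  have P7 : 21%:R = 0 :> R by [exact: (@mul3_eq0 _ 7 H)];
  have P8 : 24%:R = 0 :> R by [exact: (@mul3_eq0 _ 8 H)];
  have N1 : - 3%:R = 0 :> R by [exact: (@opp_mul3_eq0 _ 1 H)];
  have N2 : - 6%:R = 0 :> R by [exact: (@opp_mul3_eq0 _ 2 H)];
  have N3 : - 9%:R = 0 :> R by [exact: (@opp_mul3_eq0 _ 3 H)];
  have N4 : - 12%:R = 0 :> R by [exact: (@opp_mul3_eq0 _ 4 H)];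
  have N5 : - 15%:R = 0 :> R by [exact: (@opp_mul3_eq0 _ 5 H)];
  have N6 : - 18%:R = 0 :> R by [exact: (@opp_mul3_eq0 _ 6 H)];
  have N7 : - 21%:R = 0 :> R by [exact: (@opp_mul3_eq0 _ 7 H)];
  have N8 : - 24%:R = 0 :> R by [exact: (@opp_mul3_eq0 _ 8 H)];
  tac H P2 P3 P4 P5 P6 P7 P8 N1 N2 N3 N4 N5 N6 N7 N8.

Ltac ring3 H := char3_with
  ltac:(fun h0 h1 h2 h3 h4 h5 h6 h7 h8 h9 h10 h11 h12 h13 h14 h15 =>
    apply: subr0_eq; ring: h0 h1 h2 h3 h4 h5 h6 h7 h8 h9 h10 h11 h12 h13 h14 h15) H.

Ltac field3 H := char3_with
  ltac:(fun h0 h1 h2 h3 h4 h5 h6 h7 h8 h9 h10 h11 h12 h13 h14 h15 =>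
    apply: subr0_eq; field: h0 h1 h2 h3 h4 h5 h6 h7 h8 h9 h10 h11 h12 h13 h14 h15) H.

(** [Delta] at z_2 = 1, over any ring because it is also evaluated in the closed field [K]. *)
Definition delta (R : comNzRingType) (z0 z1 z3 z4 : R) : R :=
  let u := z0 * z4 - z1 * z3 in
  u ^+ 3 + u ^+ 2 - (z0 * z3 ^+ 2 + z4 * z1 ^+ 2 - z0 * z4).

(** * Meeting the cubic over a closed field *)

Section CommonZero.
Variables (K : closedFieldType) (tri : 3%:R = 0 :> K).

(* With t = 1, eliminating s^3 leaves z0 s^2 - z1 s = u, and delta is up to a
   factor the product of s - z0 s^3 - z3 over its two roots. *)
Lemma delta_eq0 (z0 z1 z3 z4 : K) :
  delta z0 z1 z3 z4 = 0 <->
  exists s t : K, [/\ (s, t) != (0, 0),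
    s ^+ 2 * t = z1 * s ^+ 3 + z4 * t ^+ 3 &
    s * t ^+ 2 = z0 * s ^+ 3 + z3 * t ^+ 3].
Proof.
split=> [D0 | [s [t [nz e1 e2]]]]; last first.
  have [t0|t0] := eqVneq t 0.
    move: nz e1 e2; rewrite t0 xpair_eqE eqxx andbT => s0.
    rewrite !expr0n /= !mulr0 !addr0 => e1 e2.
    have s3 : s ^+ 3 != 0 by rewrite expf_neq0.
    have z10 : z1 = 0 by apply: (mulIf s3); rewrite mul0r.
    have z00 : z0 = 0 by apply: (mulIf s3); rewrite mul0r.
    by rewrite /delta z10 z00; ring.
  have f1 : z4 = (s / t) ^+ 2 - z1 * (s / t) ^+ 3.
    apply: (mulIf (expf_neq0 3 t0)); apply: (addrI (z1 * s ^+ 3)).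
    by rewrite -e1; field.
  have f2 : z3 = (s / t) - z0 * (s / t) ^+ 3.
    apply: (mulIf (expf_neq0 3 t0)); apply: (addrI (z0 * s ^+ 3)).
    by rewrite -e2; field.
  by rewrite /delta f1 f2; field3 tri.
have [z00|z00] := eqVneq z0 0.
  have [z10|z10] := eqVneq z1 0.
    exists 1, 0; rewrite z00 z10 !expr0n /= !mulr0 !mul0r addr0; split=> //.
    by rewrite xpair_eqE oner_eq0.
  (* For z_0 = 0 the second equation with t = 1 forces s = z_3; z_1^2 times the difference of the
     two sides of the first is then [delta]. *)
  exists z3, 1; split; first by rewrite xpair_eqE oner_eq0 andbF.
    apply/eqP; rewrite -subr_eq0; apply/eqP.
    apply: (mulfI (expf_neq0 2 z10)); rewrite mulr0 -D0 /delta z00; ring.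
  by rewrite z00; ring.
pose u := z0 * z4 - z1 * z3.
have [s1 e1] : exists s, z0 * s ^+ 2 - z1 * s = u.
  have [s es] := @solve_monicpoly K 2 (fun i => nth 0 [:: u / z0; z1 / z0] i) isT.
  exists s; move: es; rewrite !big_ord_recl big_ord0 /= => ->.
  by field.
(* The other root, since the roots sum to z_1 / z_0. *)
pose s2 := z1 / z0 - s1.
have e2 : z0 * s2 ^+ 2 - z1 * s2 = u by rewrite -e1 /s2; field.
(* z_1 and z_4 are eliminated in favour of w and s_1, so that z_0 times the product below equals
   -[delta] by a polynomial identity. *)
pose w := z1 / z0; have z1E : z1 = w * z0 by rewrite divfK.
have z4E : z4 = s1 ^+ 2 - w * s1 + w * z3.
  apply: (mulfI z00); have -> : z0 * z4 = u + z1 * z3 by rewrite /u; ring.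
  by rewrite -e1 {1 2}z1E; ring.
have: (z0 * s1 ^+ 3 + z3 - s1) * (z0 * s2 ^+ 3 + z3 - s2) = 0.
  apply: (mulfI z00); rewrite mulr0 -[RHS]oppr0 -D0 /delta z4E /s2 -/w z1E.
  by ring3 tri.
have fin s : z0 * s ^+ 2 - z1 * s = u -> z0 * s ^+ 3 + z3 - s = 0 ->
    exists s t : K, [/\ (s, t) != (0, 0),
    s ^+ 2 * t = z1 * s ^+ 3 + z4 * t ^+ 3 &
    s * t ^+ 2 = z0 * s ^+ 3 + z3 * t ^+ 3].
  move=> eu es; have es' : z3 = s - z0 * s ^+ 3 by rewrite -[LHS]subr0 -es; ring.
  exists s, 1; split; first by rewrite xpair_eqE oner_eq0 andbF.
    apply: (mulfI z00).
    have -> : z0 * (s ^+ 2 * 1) = u + z1 * s by rewrite -eu; ring.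
    by rewrite /u es'; ring.
  by rewrite es'; ring.
move/eqP; rewrite mulf_eq0 => /orP[] /eqP.
  exact: fin.
exact: fin.
Qed.

End CommonZero.

(** * Multiplicativity of the matrices acting on PG(3,q) *)

Section CubicMatrix.
Variable F : finFieldType.
Hypothesis tri : 3%:R = 0 :> F.

Lemma lift01 : lift ord0 ord0 = 1 :> 'I_2. Proof. exact/val_inj. Qed.

Lemma mulmx2E (m n : 'M[F]_2) (i j : 'I_2) :
  (m *m n) i j = m i 0 * n 0 j + m i 1 * n 1 j.
Proof. by rewrite mxE !big_ord_recl big_ord0 addr0 lift01. Qed.

Lemma det2E (m : 'M[F]_2) : \det m = m 0 0 * m 1 1 - m 0 1 * m 1 0.
Proof.
rewrite (expand_det_row _ 0) !big_ord_recl big_ord0 /cofactor !det_mx11 !mxE /=.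
have -> : lift ord0 (0 : 'I_1) = 1 :> 'I_2 by exact/val_inj.
have -> : lift 1 (0 : 'I_1) = 0 :> 'I_2 by exact/val_inj.
have -> : ord0 = 0 :> 'I_2 by exact/val_inj.
by rewrite /bump /=; ring.
Qed.

(** [cubic_mx] describes a linear substitution in the cubic monomials with the multiples of 3
    dropped, so multiplicativity relies on characteristic 3. *)
Lemma cubic_mxM (m n : 'M[F]_2) : cubic_mx (m *m n) = cubic_mx m *m cubic_mx n.
Proof.
apply/matrixP=> [[[|[|[|[|i]]]] Hi]] [[|[|[|[|j]]]] Hj] //;
  rewrite [LHS]mxE !mulmx2E [RHS]mxE !big_ord_recl big_ord0 !mxE /bump /=;
  set a := m 0 0; set b := m 0 1; set c := m 1 0; set d := m 1 1;
  ring3 tri.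
Qed.

Lemma cubic_mx1 : cubic_mx 1%:M = 1%:M :> 'M[F]_4.
Proof.
by apply/matrixP=> [[[|[|[|[|i]]]] Hi]] [[|[|[|[|j]]]] Hj] //; rewrite !mxE /=; ring.
Qed.

End CubicMatrix.

(** * Lines as graphs over the coordinates y_0, y_3 *)

Section Graph.
Variable F : finFieldType.
Hypothesis tri : 3%:R = 0 :> F.
Implicit Types (m : 'M[F]_2) (z : F * F * F * F) (L : {set 'cV[F]_4}).

Definition col4 (a b c d : F) : 'cV[F]_4 := \col_(i < 4) [:: a; b; c; d]`_i.

Lemma col4E a b c d :
  [/\ col4 a b c d 0 0 = a, col4 a b c d 1 0 = b,
      col4 a b c d 2 0 = c & col4 a b c d 3 0 = d].
Proof. by rewrite !mxE. Qed.

Lemma col4P (v w : 'cV[F]_4) :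
  [/\ v 0 0 = w 0 0, v 1 0 = w 1 0, v 2 0 = w 2 0 & v 3 0 = w 3 0] -> v = w.
Proof.
case=> e0 e1 e2 e3; apply/colP=> -[[|[|[|[|i]]]] Hi] //.
- by rewrite (_ : Ordinal Hi = 0) //; apply: val_inj.
- by rewrite (_ : Ordinal Hi = 1) //; apply: val_inj.
- by rewrite (_ : Ordinal Hi = 2) //; apply: val_inj.
- by rewrite (_ : Ordinal Hi = 3) //; apply: val_inj.
Qed.

Lemma mulmx4E (A : 'M[F]_4) (v : 'cV[F]_4) i :
  (A *m v) i 0 = A i 0 * v 0 0 + A i 1 * v 1 0 + A i 2 * v 2 0 + A i 3 * v 3 0.
Proof.
rewrite mxE !big_ord_recl big_ord0 addr0 !addrA.
by do !congr (_ + _); congr (A _ _ * v _ _); apply/val_inj.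
Qed.

Lemma mul_cubic_mx m (v : 'cV[F]_4) :
  let a := m 0 0 in let b := m 0 1 in let c := m 1 0 in let d := m 1 1 in
  let e := a * d - b * c in
  cubic_mx m *m v =
    col4 (a ^+ 3 * v 0 0 + b ^+ 3 * v 3 0)
         (a ^+ 2 * c * v 0 0 + e * (a * v 1 0 - b * v 2 0) + b ^+ 2 * d * v 3 0)
         (a * c ^+ 2 * v 0 0 + e * (d * v 2 0 - c * v 1 0) + b * d ^+ 2 * v 3 0)
         (c ^+ 3 * v 0 0 + d ^+ 3 * v 3 0).
Proof.
by move=> a b c d e; apply: col4P; split; rewrite mulmx4E !mxE /=;
  rewrite -?/a -?/b -?/c -?/d -?/e; ring.
Qed.

(* The lines that lie in no osculating plane are those on which y_0 and y_3 are
   coordinates; the entries of z are the coefficients z_0, z_1, z_3, z_4 of the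
   associated quartic, scaled so that z_2 = 1. *)
Definition graph z : {set 'cV[F]_4} :=
  let: (z0, z1, z3, z4) := z in
  [set v : 'cV[F]_4 | (v 1 0 == z1 * v 0 0 + z4 * v 3 0)
        && (v 2 0 == z0 * v 0 0 + z3 * v 3 0)].

Definition graph_pt z (s t : F) : 'cV[F]_4 :=
  let: (z0, z1, z3, z4) := z in
  col4 s (z1 * s + z4 * t) (z0 * s + z3 * t) t.

Definition deltaq z : F := let: (z0, z1, z3, z4) := z in delta z0 z1 z3 z4.

Lemma graph_ptE z s t : graph_pt z s t \in graph z.
Proof.
case: z => [[[z0 z1] z3] z4]; rewrite inE /graph_pt.
by case: (col4E s (z1 * s + z4 * t) (z0 * s + z3 * t) t) => -> -> -> ->; rewrite !eqxx.
Qed.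

Lemma graphE z v : v \in graph z -> v = graph_pt z (v 0 0) (v 3 0).
Proof.
case: z => [[[z0 z1] z3] z4]; rewrite inE /graph_pt => /andP[/eqP e1 /eqP e2].
by apply: col4P; case: (col4E (v 0 0) (z1 * v 0 0 + z4 * v 3 0)
   (z0 * v 0 0 + z3 * v 3 0) (v 3 0)) => -> -> -> ->.
Qed.

Lemma graph_pt_inj z s t s' t' :
  graph_pt z s t = graph_pt z s' t' -> s = s' /\ t = t'.
Proof.
case: z => [[[z0 z1] z3] z4] e.
have := congr1 (fun v : 'cV_4 => v 0 0) e.
by have := congr1 (fun v : 'cV_4 => v 3 0) e; rewrite !mxE.
Qed.

Lemma graph_inj : injective graph.
Proof.
move=> z z' e; have a := graph_ptE z 1 0; have b := graph_ptE z 0 1.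
move: a b; rewrite e; case: z z' {e} => [[[z0 z1] z3] z4] [[[y0 y1] y3] y4].
rewrite !inE !mxE /= !(mulr0, mulr1, addr0, add0r).
by move=> /andP[/eqP-> /eqP->] /andP[/eqP-> /eqP->].
Qed.

(** Used to upgrade an inclusion between the image of a graph and another graph to an equality. *)
Lemma card_graph z : #|graph z| = (#|F| * #|F|)%N.
Proof.
rewrite -card_prod -(card_imset (f := fun p => graph_pt z p.1 p.2)); last first.
  by move=> [s t] [s' t'] /graph_pt_inj[/= -> ->].
apply/eq_card=> v; apply/idP/imsetP=> [/graphE-> | [p _ ->]].
  by exists (v 0 0, v 3 0).
exact: graph_ptE.
Qed.

Lemma graph_lineE (x y : 'cV[F]_4) : plucker x y 0 3 != 0 ->
  line x y = graph (plucker x y 2 3 / plucker x y 0 3,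
                    plucker x y 1 3 / plucker x y 0 3,
                    plucker x y 0 2 / plucker x y 0 3,
                    plucker x y 0 1 / plucker x y 0 3).
Proof.
rewrite /plucker; set D := x 0 0 * y 3 0 - x 3 0 * y 0 0 => D0.
apply/setP=> v; rewrite !inE.
apply/idP/idP=> [|/andP[/eqP e1 /eqP e2]].
  rewrite span_def big_cons big_seq1 => /memv_addP[_ /vlineP[k ->]].
  case=> _ /vlineP[l ->] ->; rewrite !mxE /D.
  by apply/andP; split; apply/eqP; field.
(* Cramer's rule in the coordinates (y_0, y_3). *)
have -> : v = ((v 0 0 * y 3 0 - v 3 0 * y 0 0) / D) *: x +
              ((x 0 0 * v 3 0 - x 3 0 * v 0 0) / D) *: y.
  by apply: col4P; rewrite !mxE e1 e2 /D; split; field.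
by rewrite memvD // memvZ // memv_span // !inE eqxx ?orbT.
Qed.

Lemma free_plucker (x y : 'cV[F]_4) : plucker x y 0 3 != 0 -> free [:: x; y].
Proof.
rewrite /plucker => D0; rewrite free_cons seq1_free span_seq1; apply/andP; split.
  apply/negP=> /vlineP[k xE]; move: D0; rewrite xE !mxE.
  by rewrite (_ : _ - _ = 0) ?eqxx //; ring.
by apply: contraNneq D0 => ->; rewrite !mxE; apply/eqP; ring.
Qed.

Lemma graph_line z : exists x y, [/\ graph z = line x y, free [:: x; y],
  plucker x y 0 3 = 1 &
  (plucker x y 2 3, plucker x y 1 3, plucker x y 0 2, plucker x y 0 1) = z].
Proof.
pose x := graph_pt z 1 0; pose y := graph_pt z 0 1; exists x, y.
have p03 : plucker x y 0 3 = 1.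
  by rewrite /x /y; case: z {x y} => [[[z0 z1] z3] z4]; rewrite /plucker !mxE /=; ring.
have zE : (plucker x y 2 3, plucker x y 1 3, plucker x y 0 2, plucker x y 0 1) = z.
  rewrite /x /y {p03}; case: z {x y} => [[[z0 z1] z3] z4]; rewrite /plucker !mxE /=.
  by do 3?congr (_, _); ring.
have n0 : plucker x y 0 3 != 0 by rewrite p03 oner_eq0.
split=> //; last exact: free_plucker.
by rewrite (graph_lineE n0) p03 !divr1 zE.
Qed.

Lemma is_line_graph z : is_line (graph z).
Proof.
have [x [y [e f _ _]]] := graph_line z.
by apply/existsP; exists x; apply/existsP; exists y; rewrite f e eqxx.
Qed.

(** On a graph each Plücker coordinate entering the quartic is p_03 times the matching coefficient
    of z, and [Delta] is homogeneous of degree 6. *)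
Lemma line_Delta (x y : 'cV[F]_4) z : line x y = graph z ->
  Delta (line_quartic x y) = plucker x y 0 3 ^+ 6 * deltaq z.
Proof.
move=> e; have xL : x \in graph z by rewrite -e inE memv_span ?inE ?eqxx.
have yL : y \in graph z by rewrite -e inE memv_span ?inE ?eqxx ?orbT.
move: xL yL => /graphE-> /graphE->; case: z {e} => [[[z0 z1] z3] z4].
by rewrite /Delta /line_quartic /plucker /deltaq /delta !mxE /=; ring.
Qed.

(** The numerator p_03^6 of [jinv] cancels the same factor of [Delta], whatever the basis of the
    line. *)
Lemma has_jinv_graph z r :
  has_jinv (graph z) r = (deltaq z != 0) && ((deltaq z)^-1 == r).
Proof.
apply/idP/idP; last first.
  have [x [y [e f p03 _]]] := graph_line z; move=> /andP[n0 /eqP <-].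
  apply/existsP; exists x; apply/existsP; exists y.
  rewrite f e eqxx /jinv (line_Delta (esym e)) p03 expr1n mul1r n0 /=.
  by rewrite p03 expr1n mul1r.
case/existsP=> x /existsP[y /and4P[_ /eqP /esym e D0 /eqP <-]].
move: D0; rewrite /jinv (line_Delta e) mulf_eq0 negb_or => /andP[p0 ->] /=.
by rewrite invfM mulrA divff ?mul1r.
Qed.

(** Cubing is the Frobenius map, injective because (s - t)^3 = s^3 - t^3, and [F] is finite. *)
Lemma expr3_surj (x : F) : exists s, s ^+ 3 = x.
Proof.
have inj : injective (fun s : F => s ^+ 3).
  move=> s t /= /eqP; rewrite -subr_eq0 => /eqP e; apply: subr0_eq.
  apply/eqP; have : (s - t) ^+ 3 == 0 by rewrite -e; apply/eqP; ring3 tri.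
  by rewrite expf_eq0.
by have [g _ gK] := injF_bij inj; exists (g x); rewrite gK.
Qed.

Lemma in_osculating_graph z : in_osculating_plane (graph z) = false.
Proof.
apply/negbTE/negP=> /existsP[s /existsP[t /andP[nz /subsetP sub]]].
have := sub _ (graph_ptE z 1 0); have := sub _ (graph_ptE z 0 1).
case: z {sub} => [[[z0 z1] z3] z4]; rewrite !inE !mxE /=.
rewrite !mulr0 !mulr1 sub0r subr0 oppr_eq0 !expf_eq0 /= => /eqP s0 /eqP t0.
by rewrite s0 t0 eqxx in nz.
Qed.

(** If p_03 = 0, the pairs (y_0, y_3) of the two basis vectors are proportional, so some form t y_0
    - s y_3 vanishes on the line; cube roots of s and t exhibit its zero set as an osculating
    plane. *)
Lemma not_osculating_graph L : is_line L -> ~~ in_osculating_plane L ->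
  exists z, L = graph z.
Proof.
case/existsP=> x /existsP[y /andP[_ /eqP->]] no.
have [p0|p0] := eqVneq (plucker x y 0 3) 0; last first.
  by eexists; apply: graph_lineE.
case/negP: no; move: p0; rewrite /plucker => p0.
suff [s [t [nz e1 e2]]] : exists s t, [/\ (s, t) != (0, 0),
    t * x 0 0 = s * x 3 0 & t * y 0 0 = s * y 3 0].
  have [s' es] := expr3_surj s; have [t' et] := expr3_surj t.
  apply/existsP; exists s'; apply/existsP; exists t'; apply/andP; split.
    apply: contra nz => /eqP[s0 t0]; move: es et; rewrite s0 t0 expr0n /= => <- <- //.
  apply/subsetP=> v; rewrite !inE es et.
  rewrite span_def big_cons big_seq1 => /memv_addP[_ /vlineP[k ->]].
  case=> _ /vlineP[l ->] ->; rewrite !mxE !mulrDr !(mulrCA t) !(mulrCA s) e1 e2.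
  by rewrite subrr.
(* (s, t) is the pair (y_0, y_3) of a basis vector where it is nonzero; if it vanishes for both, any
   choice works. *)
have [nx|nx] := boolP ((x 0 0, x 3 0) != (0, 0)).
  exists (x 0 0), (x 3 0); split=> //; first by rewrite mulrC.
  by apply/eqP; rewrite -subr_eq0 -oppr_eq0 -[X in _ == X]p0; apply/eqP; ring.
have [ny|ny] := boolP ((y 0 0, y 3 0) != (0, 0)).
  exists (y 0 0), (y 3 0); split=> //; last by rewrite mulrC.
  by apply/eqP; rewrite -subr_eq0 -[X in _ == X]p0; apply/eqP; ring.
move: nx ny; rewrite !negbK => /eqP[-> ->] /eqP[-> ->].
by exists 1, 0; rewrite !mulr0 xpair_eqE oner_eq0.
Qed.

End Graph.

(** * Generic lines are the graphs with nonzero discriminant *)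

Section Generic.
Variables (F : finFieldType) (K : closedFieldType) (FtoK : {rmorphism F -> K}).
Hypothesis tri : 3%:R = 0 :> F.

(** The graph has a basis of two points over [F], and the images of these two points already span
    the extension to [K]. *)
Lemma mem_extend_line z0 z1 z3 z4 (v : 'cV[K]_4) :
  v \in extend_line FtoK (graph (z0, z1, z3, z4)) <->
  v 1 0 = FtoK z1 * v 0 0 + FtoK z4 * v 3 0 /\
  v 2 0 = FtoK z0 * v 0 0 + FtoK z3 * v 3 0.
Proof.
set z := (z0, z1, z3, z4).
pose x := map_mx FtoK (graph_pt z 1 0); pose y := map_mx FtoK (graph_pt z 0 1).
have [x0 x1 x2 x3] : [/\ x 0 0 = 1, x 1 0 = FtoK z1, x 2 0 = FtoK z0 & x 3 0 = 0].
  by rewrite !mxE /= !mulr0 !mulr1 !addr0 rmorph1 rmorph0.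
have [y0 y1 y2 y3] : [/\ y 0 0 = 0, y 1 0 = FtoK z4, y 2 0 = FtoK z3 & y 3 0 = 1].
  by rewrite !mxE /= !mulr0 !mulr1 !add0r rmorph1 rmorph0.
have combE k l i : (k *: x + l *: y) i 0 = k * x i 0 + l * y i 0.
  by rewrite mxE [X in X + _]mxE [X in _ + X]mxE.
have colE (w : 'cV[K]_4) : w 1 0 = FtoK z1 * w 0 0 + FtoK z4 * w 3 0 ->
    w 2 0 = FtoK z0 * w 0 0 + FtoK z3 * w 3 0 ->
    w = w 0 0 *: x + w 3 0 *: y.
  move=> e1 e2; apply/colP=> -[[|[|[|[|i]]]] Hi] //.
  - by rewrite combE (_ : Ordinal Hi = 0) ?x0 ?y0; [ring | apply: val_inj].
  - by rewrite combE (_ : Ordinal Hi = 1) ?x1 ?y1 ?e1; [ring | apply: val_inj].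
  - by rewrite combE (_ : Ordinal Hi = 2) ?x2 ?y2 ?e2; [ring | apply: val_inj].
  - by rewrite combE (_ : Ordinal Hi = 3) ?x3 ?y3; [ring | apply: val_inj].
have -> : extend_line FtoK (graph z) = <<[:: x; y]>>%VS.
  apply/eqP; rewrite eqEsubv; apply/andP; split; apply/span_subvP=> w.
    case/mapP=> u; rewrite mem_enum => /graphE uE ->; rewrite uE.
    rewrite [X in X \in _]colE; last 2 first.
    - by rewrite !mxE /= !(rmorphD, rmorphM).
    - by rewrite !mxE /= !(rmorphD, rmorphM).
    by rewrite memvD // memvZ // memv_span // !inE eqxx ?orbT.
  rewrite !inE => /orP[] /eqP->; apply: memv_span; apply: map_f;
    by rewrite mem_enum graph_ptE.
split=> [|[e1 e2]]; last first.
  by rewrite [v]colE // memvD // memvZ // memv_span // !inE eqxx ?orbT.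
rewrite span_def big_cons big_seq1 => /memv_addP[_ /vlineP[k ->]].
case=> _ /vlineP[l ->] ->; rewrite !combE x0 x1 x2 x3 y0 y1 y2 y3.
by split; ring.
Qed.

(** For the vector [nu s t] the two graph equations are those of [delta_eq0]; vanishing of the
    discriminant passes through the injective [FtoK]. *)
Lemma meets_cubic_graph z : meets_cubic FtoK (graph z) <-> deltaq z = 0.
Proof.
have triK : 3%:R = 0 :> K by rewrite -(rmorph_nat FtoK) tri rmorph0.
case: z => [[[z0 z1] z3] z4].
have -> : (deltaq (z0, z1, z3, z4) = 0) <->
    delta (FtoK z0) (FtoK z1) (FtoK z3) (FtoK z4) = 0.
  have -> : delta (FtoK z0) (FtoK z1) (FtoK z3) (FtoK z4) =
            FtoK (deltaq (z0, z1, z3, z4)).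
    by rewrite /= /delta !(rmorphB, rmorphD, rmorphM, rmorphXn).
  by split=> /eqP => [/eqP->|]; rewrite ?rmorph0 // fmorph_eq0 => /eqP.
rewrite delta_eq0 //; split=> -[s [t]].
  case=> nz /mem_extend_line; rewrite !mxE /= => -[e1 e2].
  by exists s, t; split=> //; move: e1 e2; rewrite !expr0 !expr1 !mulr1 !mul1r.
case=> nz e1 e2; exists s, t; split=> //; apply/mem_extend_line.
by rewrite !mxE /= !expr0 !expr1 !mulr1 !mul1r.
Qed.

Lemma generic_graph z : generic FtoK (graph z) <-> deltaq z != 0.
Proof.
split=> [[_ nm _]|D0]; first by apply/eqP => /meets_cubic_graph.
split; [exact: is_line_graph | | by rewrite in_osculating_graph].
by move/meets_cubic_graph/eqP; apply/negP.
Qed.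

Lemma generic_linesP L :
  reflect (exists2 z, deltaq z != 0 & L = graph z) (L \in generic_lines FtoK).
Proof.
rewrite inE; apply: (iffP (asboolP _)) => [gL | [z D0 ->]]; last exact/generic_graph.
have [lL _ oL] := gL; have [z zE] := not_osculating_graph tri lL oL.
by exists z => //; apply/generic_graph; rewrite -zE.
Qed.

End Generic.

(** * The action on coefficients *)

Section Action.
Variable F : finFieldType.
Hypothesis tri : 3%:R = 0 :> F.
Implicit Types (m : 'M[F]_2) (z : F * F * F * F) (L : {set 'cV[F]_4}).

Lemma cubic_actM m n L : cubic_act (m *m n) L = cubic_act m (cubic_act n L).
Proof.
rewrite /cubic_act -imset_comp; apply: eq_imset => v /=.
by rewrite cubic_mxM // mulmxA.
Qed.

Lemma cubic_act1 L : cubic_act 1%:M L = L.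
Proof.
rewrite /cubic_act -[RHS]imset_id; apply: eq_imset => v.
by rewrite cubic_mx1 mul1mx.
Qed.

Lemma cubic_mx_inj m : m \in unitmx -> injective (fun v : 'cV[F]_4 => cubic_mx m *m v).
Proof.
move=> mU; apply: (can_inj (g := fun v => cubic_mx (invmx m) *m v)) => v.
by rewrite mulmxA -cubic_mxM // mulVmx // cubic_mx1 mul1mx.
Qed.

(** The first two equations put the image of the point with (y_0, y_3) = (1, 0) on the target graph,
    the last two that of the point with (0, 1). *)
Definition maps_graph (a b c d : F) z z' : Prop :=
  let e := a * d - b * c in
  let: (z0, z1, z3, z4) := z in let: (y0, y1, y3, y4) := z' in
  [/\ a ^+ 2 * c + e * (a * z1 - b * z0) = y1 * a ^+ 3 + y4 * c ^+ 3,
      a * c ^+ 2 + e * (d * z0 - c * z1) = y0 * a ^+ 3 + y3 * c ^+ 3,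
      b ^+ 2 * d + e * (a * z4 - b * z3) = y1 * b ^+ 3 + y4 * d ^+ 3 &
      b * d ^+ 2 + e * (d * z3 - c * z4) = y0 * b ^+ 3 + y3 * d ^+ 3].

Lemma cubic_act_graphP m z z' : m \in unitmx ->
  (cubic_act m (graph z) = graph z') <->
  maps_graph (m 0 0) (m 0 1) (m 1 0) (m 1 1) z z'.
Proof.
move=> mU; case: z z' => [[[z0 z1] z3] z4] [[[y0 y1] y3] y4].
set z := (z0, _, _, _); set z' := (y0, _, _, _).
have -> : (cubic_act m (graph z) = graph z') <->
   (cubic_mx m *m graph_pt z 1 0 \in graph z' /\
    cubic_mx m *m graph_pt z 0 1 \in graph z').
  split=> [<-|[ex ey]]; first by rewrite !imset_f ?graph_ptE.
  (* Both sets have q^2 vectors, so inclusion is enough. *)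
  apply/eqP; rewrite eqEcard card_imset; last exact: cubic_mx_inj.
  rewrite !card_graph leqnn andbT; apply/subsetP=> _ /imsetP[v /graphE-> ->].
  have [x [y [zE _ _ _]]] := graph_line z'.
  have -> : graph_pt z (v 0 0) (v 3 0) =
      v 0 0 *: graph_pt z 1 0 + v 3 0 *: graph_pt z 0 1.
    by apply: col4P; rewrite /graph_pt !mxE /=; split; ring.
  rewrite mulmxDr -!scalemxAr; move: ex ey; rewrite zE !inE => ex ey.
  by rewrite memvD ?memvZ.
rewrite !mul_cubic_mx /= !inE !mxE /= !(mulr0, mulr1, addr0, add0r).
split=> [[/andP[/eqP <- /eqP <-] /andP[/eqP <- /eqP <-]] | [e1 e2 e3 e4]].
  by split; ring.
by split; apply/andP; split; apply/eqP; rewrite -?e1 -?e2 -?e3 -?e4; ring.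
Qed.

End Action.

(** * Invariance of the discriminant and normal forms *)

Section DeltaInvariance.
Variable F : finFieldType.
Hypothesis tri : 3%:R = 0 :> F.
Implicit Types (m n : 'M[F]_2) (z : F * F * F * F).

Definition mx2 (a b c d : F) : 'M[F]_2 :=
  \matrix_(i, j) (nth [::] [:: [:: a; b]; [:: c; d]] i)`_j.

Lemma mx2E a b c d : [/\ mx2 a b c d 0 0 = a, mx2 a b c d 0 1 = b,
  mx2 a b c d 1 0 = c & mx2 a b c d 1 1 = d].
Proof. by rewrite !mxE. Qed.

Lemma ord2P (i : 'I_2) : i = 0 \/ i = 1.
Proof. by case: i => [[|[|i]] Hi] //; [left | right]; apply: val_inj. Qed.

Lemma mx2P m n : m 0 0 = n 0 0 -> m 0 1 = n 0 1 -> m 1 0 = n 1 0 ->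
  m 1 1 = n 1 1 -> m = n.
Proof.
move=> e0 e1 e2 e3; apply/matrixP=> i j.
by case: (ord2P i) => ->; case: (ord2P j) => ->.
Qed.

Lemma unitmx2 m : (m \in unitmx) = (m 0 0 * m 1 1 - m 0 1 * m 1 0 != 0).
Proof. by rewrite unitmxE unitfE det2E. Qed.

Lemma mx2_unit a b c d : (mx2 a b c d \in unitmx) = (a * d - b * c != 0).
Proof. by rewrite unitmx2; case: (mx2E a b c d) => -> -> -> ->. Qed.

Lemma cubic_act_mx2 a b c d z z' : a * d - b * c != 0 ->
  (cubic_act (mx2 a b c d) (graph z) = graph z') <-> maps_graph a b c d z z'.
Proof.
move=> e0; rewrite (cubic_act_graphP tri) ?mx2_unit //.
by case: (mx2E a b c d) => -> -> -> ->.
Qed.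

Definition preserves_delta m := forall z,
  exists2 z', cubic_act m (graph z) = graph z' & deltaq z' = deltaq z.

Lemma preserves_deltaM m n :
  preserves_delta m -> preserves_delta n -> preserves_delta (m *m n).
Proof.
move=> hm hn z; have [z1 e1 d1] := hn z; have [z2 e2 d2] := hm z1.
by exists z2; rewrite ?cubic_actM // ?e1 // d2.
Qed.

(** Found by solving [maps_graph 1 b 0 1] for the target coefficients; b = z_1 / z_0 kills z_1. *)
Definition translate (b : F) z : F * F * F * F :=
  let: (z0, z1, z3, z4) := z in
  (z0, z1 - b * z0, z3 + b - z0 * b ^+ 3,
   z4 + b ^+ 2 - b * z3 - (z1 - b * z0) * b ^+ 3).

Lemma cubic_act_translate b z :
  cubic_act (mx2 1 b 0 1) (graph z) = graph (translate b z).
Proof.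
apply/cubic_act_mx2; first by rewrite mulr1 mulr0 subr0 oner_eq0.
by case: z => [[[z0 z1] z3] z4]; split; ring.
Qed.

Lemma deltaq_translate b z : deltaq (translate b z) = deltaq z.
Proof. by case: z => [[[z0 z1] z3] z4]; rewrite /= /delta; ring3 tri. Qed.

Definition swap z : F * F * F * F := let: (z0, z1, z3, z4) := z in (z4, z3, z1, z0).

Lemma cubic_act_swap z : cubic_act (mx2 0 1 1 0) (graph z) = graph (swap z).
Proof.
apply/cubic_act_mx2; first by rewrite mulr0 mulr1 sub0r oppr_eq0 oner_eq0.
by case: z => [[[z0 z1] z3] z4]; split; ring.
Qed.

Lemma deltaq_swap z : deltaq (swap z) = deltaq z.
Proof. by case: z => [[[z0 z1] z3] z4]; rewrite /= /delta; ring. Qed.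

Lemma preserves_delta_diag a d : a != 0 -> d != 0 -> preserves_delta (mx2 a 0 0 d).
Proof.
move=> a0 d0 [[[z0 z1] z3] z4].
(* z_i is multiplied by (d / a)^(2 - i), and every term of [delta] has total weight 0. *)
exists (d ^+ 2 * z0 / a ^+ 2, d * z1 / a, a * z3 / d, a ^+ 2 * z4 / d ^+ 2).
  apply/cubic_act_mx2; first by rewrite mul0r subr0 mulf_neq0.
  by split; field; rewrite ?a0 ?d0.
by rewrite /= /delta; field; rewrite a0 d0.
Qed.

Lemma preserves_delta_upper a b d : a != 0 -> d != 0 -> preserves_delta (mx2 a b 0 d).
Proof.
move=> a0 d0.
have -> : mx2 a b 0 d = mx2 a 0 0 d *m mx2 1 (b / a) 0 1.
  by apply: mx2P; rewrite mulmx2E !mxE /=; field.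
apply: preserves_deltaM; first exact: preserves_delta_diag.
by move=> z; exists (translate (b / a) z); rewrite ?cubic_act_translate ?deltaq_translate.
Qed.

(* By the Bruhat decomposition. *)
Lemma preserves_delta_unit m : m \in unitmx -> preserves_delta m.
Proof.
rewrite unitmx2; set a := m 0 0; set b := m 0 1; set c := m 1 0; set d := m 1 1 => e0.
have [c0|c0] := eqVneq c 0.
  have -> : m = mx2 a b 0 d by apply: mx2P; rewrite !mxE.
  move: e0; rewrite c0 mulr0 subr0 mulf_eq0 negb_or => /andP[a0 d0].
  exact: preserves_delta_upper.
have -> : m = mx2 1 (a / c) 0 1 *m (mx2 0 1 1 0 *m mx2 c d 0 (- (a * d - b * c) / c)).
  apply: mx2P; rewrite !mulmx2E !mxE /= -?/a -?/b -?/c -?/d; field => //.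
apply: preserves_deltaM.
  by move=> z; exists (translate (a / c) z); rewrite ?cubic_act_translate ?deltaq_translate.
apply: preserves_deltaM.
  by move=> z; exists (swap z); rewrite ?cubic_act_swap ?deltaq_swap.
apply: preserves_delta_upper => //.
by rewrite mulf_neq0 ?invr_eq0 ?oppr_eq0.
Qed.

(** Once z_0 <> 0 a translation kills z_1. A nonzero z_0 is reached by a swap if z_4 <> 0, and by a
    translation followed by a swap if z_0 = z_4 = 0. *)
Lemma exists_normal_form z : deltaq z != 0 ->
  exists2 m, m \in unitmx & exists z0 z3 z4 : F,
    [/\ cubic_act m (graph z) = graph (z0, 0, z3, z4), z0 != 0 &
        deltaq (z0, 0, z3, z4) = deltaq z].
Proof.
have U b : mx2 1 b 0 1 \in unitmx by rewrite mx2_unit mulr1 mulr0 subr0 oner_eq0.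
have W : mx2 0 1 1 0 \in unitmx.
  by rewrite mx2_unit mulr0 mulr1 sub0r oppr_eq0 oner_eq0.
have nf0 z' : z'.1.1.1 != 0 -> exists2 m, m \in unitmx & exists z0 z3 z4 : F,
    [/\ cubic_act m (graph z') = graph (z0, 0, z3, z4), z0 != 0 &
        deltaq (z0, 0, z3, z4) = deltaq z'].
  case: z' => [[[z0 z1] z3] z4] /= z00.
  have tE : z1 - z1 / z0 * z0 = 0 by rewrite divfK ?subrr.
  have := deltaq_translate (z1 / z0) (z0, z1, z3, z4).
  have := cubic_act_translate (z1 / z0) (z0, z1, z3, z4).
  rewrite /translate tE => eA eD; exists (mx2 1 (z1 / z0) 0 1) => //.
  by do 3!eexists; split; [exact: eA | | exact: eD].
have lift m z' : m \in unitmx -> cubic_act m (graph z) = graph z' ->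
    deltaq z' = deltaq z -> z'.1.1.1 != 0 ->
    exists2 m, m \in unitmx & exists z0 z3 z4 : F,
    [/\ cubic_act m (graph z) = graph (z0, 0, z3, z4), z0 != 0 &
        deltaq (z0, 0, z3, z4) = deltaq z].
  move=> mU e dE /nf0[n nU [z0 [z3 [z4 [e' z00 dE']]]]].
  exists (n *m m); first by rewrite unitmx_mul nU.
  by exists z0, z3, z4; rewrite cubic_actM // e e' dE' dE.
case: z lift => [[[z0 z1] z3] z4] lift D0.
have [z00|] := eqVneq z0 0; last by move=> z00; apply: nf0.
have [z40|z40] := eqVneq z4 0; last first.
  by apply: (lift _ _ W (cubic_act_swap _)); rewrite ?deltaq_swap.
pose z' b := swap (translate b (z0, z1, z3, z4)).
suff [b zb] : exists b, (z' b).1.1.1 != 0.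
  apply: (lift (mx2 0 1 1 0 *m mx2 1 b 0 1) (z' b)) => //.
  - by rewrite unitmx_mul W U.
  - by rewrite cubic_actM // cubic_act_translate cubic_act_swap.
  - by rewrite deltaq_swap deltaq_translate.
rewrite /z' /= z00 z40.
(* The new leading coefficient is b^2 - b z_3 - b^3 z_1; its values at b = 1 and b = -1 sum to 2, so
   they do not both vanish. *)
have [e1|] := eqVneq (1 - z3 - z1) 0; last first.
  by move=> e1; exists 1; apply: contraNneq e1 => <-; apply/eqP; ring.
exists (- 1); apply: contra_neq (oner_neq0 F) => e2.
have {}e1 : z3 = 1 - z1 by apply: subr0_eq; rewrite -[RHS]oppr0 -e1; ring.
by rewrite -[RHS]oppr0 -e2 e1; ring3 tri.
Qed.

End DeltaInvariance.

(** * The stabilizer of a line in normal form *)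

Section Stabilizer.
Variable F : finFieldType.
Hypothesis tri : 3%:R = 0 :> F.

Definition fcubic (r T : F) : F := T ^+ 3 - r * T + r.

Definition num_roots (r : F) : nat := #|[set T | fcubic r T == 0]|.

Variables z0 z3 z4 : F.
Let z : F * F * F * F := (z0, 0, z3, z4).
Let u := z0 * z4.
Hypotheses (z0_neq0 : z0 != 0) (delta_neq0 : deltaq z != 0).

(** If (a b; 1 -a) fixes the line and B = 1 + z_0 b, then a B = z_3 and u = z_0 a^2 B + (B - 1)^2;
    multiplying the latter by B eliminates a and gives this cubic. *)
Definition scubic (B : F) : F := B ^+ 3 + B ^+ 2 + B * (1 - u) + z0 * z3 ^+ 2.

(* The substitution is B = 1 - u - 1/T. *)
Lemma card_scubic : #|[set B | scubic B == 0]| = num_roots (deltaq z)^-1.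
Proof.
have sE B : (1 - u - B) ^+ 3 * deltaq z * fcubic (deltaq z)^-1 (1 - u - B)^-1
    = (if 1 - u == B then 0 else - scubic B).
  case: eqP => [->|/eqP nB]; first by rewrite subrr expr0n /= !mul0r.
  have hB : 1 - u - B != 0 by rewrite subr_eq0.
  rewrite /fcubic.
  have -> : (1 - u - B) ^+ 3 * deltaq z *
      ((1 - u - B)^-1 ^+ 3 - (deltaq z)^-1 * (1 - u - B)^-1 + (deltaq z)^-1) =
      deltaq z - (1 - u - B) ^+ 2 + (1 - u - B) ^+ 3.
    by field; rewrite hB delta_neq0.
  by rewrite /scubic /deltaq /z /delta /u; ring3 tri.
(* So B = 1 - u, where the substitution breaks down, is never a root. *)
have s1 : scubic (1 - u) = - deltaq z.
  by rewrite /scubic /deltaq /z /delta /u; ring3 tri.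
rewrite /num_roots -(card_in_imset (f := fun B => (1 - u - B)^-1)); last first.
  by move=> B C _ _ /invr_inj /addrI /oppr_inj.
apply/eq_card=> T; apply/imsetP/idP; last first.
  rewrite inE => fT; have T0 : T != 0.
    apply: contraTneq fT => ->; rewrite /fcubic expr0n mulr0 subr0 add0r.
    by rewrite invr_eq0.
  have TE : (1 - u - (1 - u - T^-1))^-1 = T by rewrite opprB addrC subrK invrK.
  exists (1 - u - T^-1); rewrite ?TE // inE.
  have := sE (1 - u - T^-1); rewrite TE (eqP fT) mulr0.
  case: eqP => [/esym/eqP|_ /esym/eqP]; rewrite ?oppr_eq0 //.
  rewrite -subr_eq0 addrAC subrr sub0r.
  by rewrite oppr_eq0 invr_eq0 (negPf T0).
case=> B; rewrite !inE => /eqP sB ->.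
have nB : 1 - u != B.
  by apply: contraNneq delta_neq0 => e; rewrite -oppr_eq0 -s1 e sB.
have := sE B; rewrite (negPf nB) sB oppr0 => /eqP.
by rewrite !mulf_eq0 subr_eq0 (negPf nB) (negPf delta_neq0).
Qed.

(* Modulo scalars the nontrivial elements of the stabilizer are the traceless
   matrices (a b; 1 -a) with B = 1 + z0 b a root of scubic and a B = z3; when
   B = 0 is a root, the corresponding element is diag(-1, 1) instead. *)
Definition stab_elt (p : F * option F) : 'M[F]_2 :=
  let: (k, o) := p in
  match o with
  | None => mx2 k 0 0 k
  | Some B => if B == 0 then mx2 (- k) 0 0 k
              else mx2 (k * z3 / B) (k * (B - 1) / z0) k (- (k * z3 / B))
  end.

(** k is the scalar factor, [None] stands for the class of the identity and [Some B] for an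
    involution. *)
Definition stab_param : {set F * option F} :=
  [set p | (p.1 != 0) && (if p.2 is Some B then scubic B == 0 else true)].

Lemma card_stab_param :
  #|stab_param| = (#|F|.-1 * (1 + num_roots (deltaq z)^-1))%N.
Proof.
have -> : stab_param =
    setX [set~ 0] (None |: [set Some B | B in [set B | scubic B == 0]]).
  apply/setP=> -[k o]; rewrite !inE /=; congr (_ && _).
  case: o => [B|] //=; apply/idP/imsetP=> [sB|[C]]; first by exists B; rewrite ?inE.
  by rewrite inE => sC [->].
rewrite cardsX cardsC1 cardsU1 card_imset; last by move=> B C [].
rewrite card_scubic; congr (_ * (_ + _))%N.
by rewrite (_ : _ \notin _ = true) //; apply/imsetP=> -[].
Qed.

Lemma oppr_neq3 (k : F) : k != 0 -> - k != k.
Proof.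
move=> k0; apply: contraNneq k0 => e; apply/eqP.
have -> : k = - k - k by ring3 tri.
by rewrite {1}e subrr.
Qed.

Lemma stab_elt_inj : {in stab_param &, injective stab_elt}.
Proof.
have f00 a b c d a' b' c' d' : mx2 a b c d = mx2 a' b' c' d' ->
    [/\ a = a', b = b', c = c' & d = d'] :> Prop.
  move=> e; have eij i j := congr1 (fun m : 'M_2 => m i j) e.
  by have := (eij 0 0, eij 0 1, eij 1 0, eij 1 1); rewrite !mxE /= => -[[[]]].
move=> [k o] [l o']; rewrite !inE /= => /andP[k0 _] /andP[l0 _].
case: o o' => [B|] [C|]; rewrite /=.
- have [-> | B0] := eqVneq B 0; have [-> | C0] := eqVneq C 0 => /f00[ea eb ec ed].
  + by rewrite ed.
  + by rewrite ec eqxx in l0.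
  + by rewrite ec eqxx in k0.
  + congr (_, Some _) => //; move: eb; rewrite ec => /(mulIf _)-/(_ _)/(mulfI l0).
    by rewrite invr_eq0 => /(_ z0_neq0)/addIr.
- case: eqP => [_|_] /f00[ea eb ec ed]; last by rewrite ec eqxx in k0.
  by move: (oppr_neq3 k0); rewrite ea ed eqxx.
- case: eqP => [_|_] /f00[ea eb ec ed]; last by rewrite -ec eqxx in l0.
  by move: (oppr_neq3 l0); rewrite -ea -ed eqxx.
by move=> /f00[-> _ _ _].
Qed.

(** In characteristic 3, u^2 + u + 1 is (u - 1)^2. *)
Lemma deltaqE : deltaq z = u * (u - 1) ^+ 2 - z0 * z3 ^+ 2.
Proof. by rewrite /deltaq /z /delta /u; ring3 tri. Qed.

Lemma stab_elt_maps p : p \in stab_param ->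
  stab_elt p \in unitmx /\ cubic_act (stab_elt p) (graph z) = graph z.
Proof.
case: p => k o; rewrite inE /= => /andP[k0].
have Z (m : 'M_2) : m \in unitmx /\ maps_graph (m 0 0) (m 0 1) (m 1 0) (m 1 1) z z ->
    m \in unitmx /\ cubic_act m (graph z) = graph z.
  by case=> mU /(cubic_act_graphP tri _ _ mU).
case: o => [B /eqP sB|_]; apply: Z; last first.
  case: (mx2E k 0 0 k) => -> -> -> ->; split; last by split; ring.
  by rewrite mx2_unit mul0r subr0 mulf_neq0.
have [B0|B0] := eqVneq B 0.
  have z30 : z3 = 0.
    apply/eqP; move/eqP: sB; rewrite /scubic B0 !expr0n mul0r !add0r.
    by rewrite mulf_eq0 (negPf z0_neq0) expf_eq0.
  case: (mx2E (- k) 0 0 k) => -> -> -> ->; rewrite mx2_unit /z z30.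
  by split; last (by split; ring); rewrite mul0r subr0 mulf_neq0 ?oppr_eq0.
(* The equation of [scubic] solved for u. *)
have uE : u = z0 * z3 ^+ 2 / B + (B - 1) ^+ 2.
  apply: (mulIf B0); apply: subr0_eq; rewrite -[RHS]oppr0 -sB /scubic.
  by field3 tri.
have z4E : z4 = (z0 * z3 ^+ 2 / B + (B - 1) ^+ 2) / z0 by rewrite -uE /u; field.
split; last first.
  case: (mx2E (k * z3 / B) (k * (B - 1) / z0) k (- (k * z3 / B))) => -> -> -> ->.
  by rewrite /maps_graph /z z4E; split; field3 tri; rewrite ?B0 ?z0_neq0.
(* A zero determinant would give z_0 z_3^2 = -B^2 (B - 1), then u = 1 - B, and the discriminant
   would vanish. *)
rewrite mx2_unit; apply: contra delta_neq0 => /eqP e0; apply/eqP.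
have e1 : z0 * z3 ^+ 2 = - B ^+ 2 * (B - 1).
  have -> : z0 * z3 ^+ 2 = - B ^+ 2 * (B - 1)
     - z0 * B ^+ 2 / k ^+ 2 * (k * z3 / B * - (k * z3 / B) - k * (B - 1) / z0 * k).
    by field; rewrite k0 B0 z0_neq0.
  by rewrite e0 mulr0 subr0.
have {}uE : u = 1 - B.
  by rewrite uE e1; apply: subr0_eq; field3 tri.
by rewrite deltaqE uE e1; ring3 tri.
Qed.

(* The inverse of (a b; c d) is proportional to (-d b; c -a) and also stabilizes
   the line; comparing the two sets of equations gives a^2 = d^2. *)
Lemma stab_elt_surj (a b c d : F) : a * d - b * c != 0 -> maps_graph a b c d z z ->
  exists2 p, p \in stab_param & mx2 a b c d = stab_elt p.
Proof.
move=> e0 S; have S' : maps_graph (- d) b c (- a) z z.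
  have e0' : - d * - a - b * c != 0 by rewrite mulrNN (mulrC d).
  apply/cubic_act_mx2 => //.
  have {1}-> : graph z = cubic_act (mx2 a b c d) (graph z).
    by apply/esym/cubic_act_mx2.
  rewrite -cubic_actM //.
  have -> : mx2 (- d) b c (- a) *m mx2 a b c d =
      mx2 (- (a * d - b * c)) 0 0 (- (a * d - b * c)).
    by apply: mx2P; rewrite mulmx2E !mxE /=; ring.
  apply/cubic_act_mx2 => //; last by split; ring.
  by rewrite mul0r subr0 mulf_neq0 ?oppr_eq0.
case: S => S1 S2 S3 S4; case: S' => T1 T2 _ _.
have [c0|c0] := eqVneq c 0.
  move: S1 S2 S3 S4 e0; rewrite c0 !expr0n /= !(mulr0, mul0r, addr0, add0r, subr0).
  rewrite mulf_eq0 negb_or => S1 S2 S3 S4 /andP[a0 d0].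
  have b0 : b = 0.
    apply/eqP; move/eqP: S1; rewrite mulrN oppr_eq0 !mulf_eq0.
    by rewrite (negPf a0) (negPf d0) (negPf z0_neq0) /= orbF.
  have a2 : d ^+ 2 = a ^+ 2.
    apply: (mulfI a0); apply: (mulIf z0_neq0).
    have -> : a * d ^+ 2 * z0 = a * d * (d * z0) by ring.
    by rewrite S2; ring.
  rewrite b0; move/eqP: a2; rewrite eqf_sqr => /orP[] /eqP dE.
    by exists (a, None); rewrite ?inE ?a0 // dE.
  (* Here d = -a, and S4 reads 2 d^3 z_3 = 0; z_3 = 0 is what makes B = 0 a root of [scubic]. *)
  have z30 : z3 = 0.
    have: 2%:R * d ^+ 3 * z3 = 0.
      have -> : 2%:R * d ^+ 3 * z3 = z0 * b ^+ 3 + z3 * d ^+ 3 - (- d * d * (d * z3)).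
        by rewrite b0; ring.
      by rewrite -S4 b0 dE; ring.
    move/eqP; rewrite 2!mulf_eq0 expf_eq0 /= (negPf d0) /= => /orP[|/eqP //].
    rewrite orbF => /eqP t2; have := oppr_neq3 (oner_neq0 F).
    by rewrite eq_sym -addr_eq0 -[1 + 1]/(2%:R) t2 eqxx.
  exists (d, Some 0); rewrite ?inE /= -?dE ?d0 //=.
    by rewrite /scubic z30; apply/eqP; ring.
  by rewrite eqxx dE opprK.
have : (a - d) * (a + d) == 0.
  have -> : (a - d) * (a + d) = a ^+ 2 - d ^+ 2 by ring.
  rewrite subr_eq0; apply/eqP; apply: (mulIf c0).
  apply: subr0_eq; apply/eqP; rewrite -(subrr (z4 * c ^+ 3)).
  have -> : z4 * c ^+ 3 = 0 * a ^+ 3 + z4 * c ^+ 3 by ring.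
  rewrite -{1}S1.
  have -> : 0 * a ^+ 3 + z4 * c ^+ 3 = 0 * (- d) ^+ 3 + z4 * c ^+ 3 by ring.
  by rewrite -T1; apply/eqP; ring.
rewrite mulf_eq0 subr_eq0 addr_eq0 => ad.
(* This contradiction rules out both degenerate cases met below. *)
have u_neq1 : z3 = 0 -> u = 1 -> False.
  move=> z30 u1; move/negP: delta_neq0; apply; rewrite deltaqE z30 u1.
  by apply/eqP; ring.
(* The case d = a <> 0 is impossible when c <> 0: S2 + T2 gives z_3 = 0, then S2 gives c = b z_0,
   and S1 gives u = 1. *)
have [da | dna] := eqVneq d (- a); last first.
  have dE : d = a.
    by case/orP: ad => /eqP // aE; move: dna; rewrite aE opprK eqxx.
  have a0 : a != 0 by apply: contraNneq dna => aE; rewrite dE aE oppr0.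
  have z30 : z3 = 0.
    apply: (mulIf (expf_neq0 3 c0)); rewrite mul0r.
    have -> : z3 * c ^+ 3 = - (z0 * a ^+ 3 + z3 * c ^+ 3)
                            - (z0 * (- d) ^+ 3 + z3 * c ^+ 3).
      by rewrite dE; ring3 tri.
    by rewrite -S2 -T2 dE; ring.
  have cE : c = b * z0.
    apply: (mulfI (mulf_neq0 a0 c0)); apply: subr0_eq.
    have -> : a * c * c - a * c * (b * z0) = a * c ^+ 2
      + (a * d - b * c) * (d * z0 - c * 0) - (z0 * a ^+ 3 + z3 * c ^+ 3).
      by rewrite dE z30; ring.
    by rewrite S2 subrr.
  have b0 : b != 0 by apply: contraNneq c0 => b0; rewrite cE b0 mul0r.
  case: (u_neq1 z30); apply: (mulIf (mulf_neq0 b0 (expf_neq0 2 c0))).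
  have -> : u * (b * c ^+ 2) = 0 * a ^+ 3 + z4 * c ^+ 3 by rewrite /u cE; ring.
  by rewrite -S1 dE cE; ring.
pose B := 1 + z0 * b / c.
have bE : b = c * (B - 1) / z0 by rewrite /B; field; rewrite z0_neq0.
have BE : a * B = c * z3.
  apply: (mulIf (expf_neq0 2 c0)).
  have -> : a * B * c ^+ 2 = z0 * a ^+ 3 + z3 * c ^+ 3 - z0 * a ^+ 3.
    by rewrite -S2 da /B; field.
  by ring.
have uE : u = z0 * (a / c) ^+ 2 * B + (B - 1) ^+ 2.
  apply: (mulIf (expf_neq0 3 c0)).
  have -> : u * c ^+ 3 = z0 * (0 * a ^+ 3 + z4 * c ^+ 3) by rewrite /u; ring.
  by rewrite -S1 da /B; field.
have sB : scubic B = 0.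
  have -> : scubic B = z0 * ((c * z3) ^+ 2 - (a * B) ^+ 2) / c ^+ 2.
    by rewrite /scubic uE; field3 tri.
  by rewrite BE; field.
exists (c, Some B); first by rewrite inE c0 /= sB.
(* B = 0 would force z_3 = 0 and u = 1, so no matrix with c <> 0 has this parameter, which is free
   to encode the diagonal involution. *)
rewrite /=; case: eqP => [B0|/eqP B0].
  have z30 : z3 = 0.
    by apply: (mulfI c0); rewrite -BE B0 !mulr0.
  by case: (u_neq1 z30); rewrite uE B0; ring.
have aE : a = c * z3 / B by rewrite -BE mulfK.
by rewrite -bE -aE da.
Qed.

End Stabilizer.

(** * Orbit sizes by the orbit-stabilizer theorem *)

Section Orbits.
Variable F : finFieldType.
Hypothesis tri : 3%:R = 0 :> F.
Local Notation GL := ('GL_2[F])%g.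

(** For GL_2 the action is defined on all sets of vectors; the inverse turns the left action into a
    right one, as [TotalAction] requires. *)
Definition GL_act (L : {set 'cV[F]_4}) (g : {'GL_2[F]}) : {set 'cV[F]_4} :=
  cubic_act (GLval g^-1%g) L.

Lemma GL_act1 L : GL_act L 1%g = L.
Proof. by rewrite /GL_act invg1 GL_1E cubic_act1. Qed.

Lemma GL_actM L : act_morph GL_act L.
Proof. by move=> g h; rewrite /GL_act invMg GL_ME cubic_actM. Qed.

Definition GL_action := TotalAction GL_act1 GL_actM.

Lemma GL_actE L g : GL_action L g = cubic_act (GLval g^-1%g) L.
Proof. by []. Qed.

Lemma GLval_surj (m : 'M[F]_2) : m \in unitmx -> exists g : {'GL_2[F]}, GLval g = m.
Proof. by move=> mU; exists (FinRing.unit 'M_(2.-1.+1) mU). Qed.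

Lemma GLval_unit (g : {'GL_2[F]}) : GLval g \in unitmx.
Proof. exact: (valP g). Qed.

(** Scalar matrices fix every line, so the representatives chosen by [pgl_act] do not matter and
    orbits can be taken under GL_2. *)
Lemma line_orbitE L : is_line L -> line_orbit L = orbit GL_action GL L.
Proof.
move=> lL; apply/setP=> M; apply/imsetP/orbitP => [[g gP ->] | [g _ <-]].
  case/morphimP: gP => h _ _ ->; exists h^-1%g; rewrite ?inE //.
  by rewrite GL_actE invgK -pgl_act_coset.
exists (coset 'Z(GL) g^-1%g); last by rewrite pgl_act_coset.
rewrite mem_quotient // inE.
Qed.

Lemma GL_center : 'Z(GL)%g = [set g | is_scalar_mx (GLval g)].
Proof.
apply/setP=> g; rewrite [RHS]inE; apply/idP/idP=> [/GL2_center[k _ ->] | ].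
  exact: scalar_mx_is_scalar.
case/is_scalar_mxP=> k gE; apply/centerP; split; first by rewrite inE.
move=> h _; apply: val_inj; rewrite -[LHS]/(GLval (g * h)) -[RHS]/(GLval (h * g)).
by rewrite !GL_MxE gE scalar_mxC.
Qed.

Lemma card_GL_center : #|'Z(GL)%g| = #|F|.-1.
Proof.
rewrite GL_center -(card_imset _ (@val_inj _ _ _)) -(cardsC1 (0 : F)).
rewrite -(card_imset (f := fun k : F => k%:M : 'M_2) [set~ 0]); last first.
  by move=> k l /(congr1 (fun m : 'M_2 => m 0 0)); rewrite !mxE.
apply/eq_card=> m; apply/imsetP/imsetP => [[g] | [k]]; rewrite inE.
  case/is_scalar_mxP=> k gE ->; exists k => //; rewrite !inE.
  apply: contraTneq (GLval_unit g) => k0; rewrite gE k0.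
  by rewrite unitmxE det_scalar expr0n unitr0.
rewrite inE => k0 ->.
have [|g gE] := @GLval_surj k%:M; first by rewrite unitmxE det_scalar unitrX ?unitfE.
exists g; last exact: esym gE.
by rewrite inE gE scalar_mx_is_scalar.
Qed.

Lemma card_PGL2 : #|PGL2 F| = (#|F| * #|F|.-1 * #|F|.+1)%N.
Proof.
have F1 : (0 < #|F|.-1)%N by rewrite -subn1 subn_gt0 finNzRing_gt1.
have nZ : (GL \subset 'N('Z(GL)))%g by exact: normal_norm (center_normal _).
have := Lagrange (center_sub [group of GL]); rewrite -card_quotient //= card_GL_center.
rewrite card_GL_2 => e; apply/eqP; rewrite -(eqn_pmul2l F1); apply/eqP.
by rewrite [LHS]e; ring.
Qed.

Lemma card_GL_stab z0 z3 z4 (z := (z0, 0, z3, z4)) : z0 != 0 -> deltaq z != 0 ->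
  #|('C_GL[graph z | GL_action])%g| = (#|F|.-1 * (1 + num_roots (deltaq z)^-1))%N.
Proof.
move=> z00 D0; rewrite -card_stab_param //.
rewrite -(card_in_imset (@stab_elt_inj _ tri z0 z3 z4 z00)).
rewrite -(card_imset (f := fun g : {'GL_2[F]} => GLval g^-1%g)); last first.
  by move=> g h /val_inj/invg_inj.
apply/eq_card=> m; apply/imsetP/imsetP => [[g] | [p pP ->]].
  case/setIP=> _ /astab1P; rewrite GL_actE => gz ->.
  have mU := GLval_unit g^-1; move: gz; set n := GLval _ in mU * => nz.
  have [||p pP e] := @stab_elt_surj _ tri z0 z3 z4 z00 D0 (n 0 0) (n 0 1) (n 1 0) (n 1 1).
  - by rewrite -unitmx2.
  - exact/(cubic_act_graphP tri _ _ mU).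
  by exists p; rewrite // -e; apply: mx2P; rewrite !mxE.
have [pU pz] := stab_elt_maps tri z00 D0 pP; have [g gE] := GLval_surj pU.
exists g^-1%g; rewrite ?invgK //.
by apply/setIP; split; [rewrite inE | apply/astab1P; rewrite GL_actE invgK gE].
Qed.

(** Orbit-stabilizer at a normal form in the same orbit; the normal form has the same discriminant,
    and the q - 1 scalars cancel. *)
Lemma card_line_orbit (z : F * F * F * F) : deltaq z != 0 ->
  (#|line_orbit (graph z)| * (1 + num_roots (deltaq z)^-1))%N = #|PGL2 F|.
Proof.
move=> D0; have [m mU [z0 [z3 [z4 [mz z00 D]]]]] := exists_normal_form tri D0.
have [g gE] := GLval_surj mU.
have -> : line_orbit (graph z) = orbit GL_action GL (graph (z0, 0, z3, z4)).
  rewrite line_orbitE ?is_line_graph //; apply/esym/orbit_eqP/orbitP.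
  by exists g^-1%g; rewrite ?inE // GL_actE invgK gE.
have F1 : (0 < #|F|.-1)%N by rewrite -subn1 subn_gt0 finNzRing_gt1.
apply/eqP; rewrite -(eqn_pmul2l F1) -D mulnCA -card_GL_stab ?D //.
by rewrite card_orbit_stab card_GL_2 card_PGL2; apply/eqP; ring.
Qed.

End Orbits.

(** * Counting along fibers *)

Section Fibers.

Lemma card_fibers (T U : finType) (f : T -> U) (A : {set T}) (k : nat) :
  {in A, forall x, #|[set y in A | f y == f x]| = k} -> #|A| = (#|f @: A| * k)%N.
Proof.
move=> fk; rewrite -sum1_card (partition_big_imset f) /= -sum_nat_const.
apply: eq_bigr => _ /imsetP[x xA ->]; rewrite sum1dep_card -(fk x xA).
by apply: eq_card => y; rewrite !inE.
Qed.

Variables (V W : finZmodType) (f : {additive V -> W}).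

Lemma card_additive_fiber x : #|[set y | f y == f x]| = #|[set y | f y == 0]|.
Proof.
rewrite -[RHS](card_imset _ (addIr x)); apply/eq_card=> y; rewrite inE.
apply/eqP/imsetP=> [e|[v]]; last by rewrite inE => /eqP v0 ->; rewrite raddfD v0 add0r.
by exists (y - x); rewrite ?subrK // inE raddfB e subrr.
Qed.

Lemma card_additive : #|V| = (#|f @: setT| * #|[set y | f y == 0%R]|)%N.
Proof.
rewrite -cardsT; apply: card_fibers => x _; rewrite -(card_additive_fiber x).
by apply: eq_card => y; rewrite !inE.
Qed.

End Fibers.

(** * Trace, Artin-Schreier equation and the sizes of the classes J_i *)

Section TraceKernel.
Variables (F : finFieldType) (char3 : 3%N \in [pchar F]).
Let tri : 3%:R = 0 :> F := pcharf0 char3.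
Local Notation trace := (trace3 char3).

Fact trace3_is_zmod_morphism : zmod_morphism trace.
Proof. exact: (raddfB (galTrace 1%AS {: pPrimeCharType char3}%AS)). Qed.

HB.instance Definition _ :=
  GRing.isZmodMorphism.Build F F trace trace3_is_zmod_morphism.

(** Cubing generates the Galois group over the prime field, and the trace is Galois-invariant. *)
Lemma trace3_cube x : trace (x ^+ 3) = trace x.
Proof.
have [a gen aE] := finField_galois_generator
  (sub1v {: pPrimeCharType char3}%AS).
have aG : a \in 'Gal({: pPrimeCharType char3} / 1)%g by rewrite (eqP gen) cycle_id.
have aX (y : pPrimeCharType char3) : a y = y ^+ 3.
  by rewrite aE ?memvf // dimv1 expn1 card_Fp.
rewrite /trace3 -[RHS](galTrace_gal (memvf (x : pPrimeCharType char3)) aG).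
by rewrite aX.
Qed.

(** The trace lies in the prime field, so it is a root of X^3 - X. *)
Lemma trace3_prime x : [\/ trace x = 0, trace x = 1 | trace x = -1].
Proof.
have [k kE] : exists k : nat, trace x = k%:R.
  have := mem_galTrace (finField_galois (sub1v {: pPrimeCharType char3}%AS))
    (memvf (x : pPrimeCharType char3)).
  by case/vlineP=> k e; exists k; rewrite /trace3 e; apply: mulr1.
have e3 : trace x ^+ 3 = trace x.
  by rewrite kE -[LHS](pFrobenius_autE char3) pFrobenius_aut_nat.
have /eqP : trace x * ((trace x - 1) * (trace x + 1)) = 0.
  by rewrite -[RHS](subrr (trace x)) -{4}e3; ring.
rewrite !mulf_eq0 subr_eq0 addr_eq0.
by case/or3P=> /eqP; [exact: Or31 | exact: Or32 | exact: Or33].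
Qed.

(** Linear independence of the Galois automorphisms, with all coefficients 1. *)
Lemma trace3_neq0 : exists x, trace x != 0.
Proof.
have [x _ nz] := @gal_independent_contra _ (pPrimeCharType char3) {: pPrimeCharType char3}%AS
  [in 'Gal({: pPrimeCharType char3} / 1)%g] (fun=> 1) _ (group1 _) (oner_neq0 _).
exists x; rewrite /trace3 /galTrace.
by under eq_bigr do rewrite -[_ x]mul1r.
Qed.

Definition artin (x : F) : F := x ^+ 3 - x.

Fact artin_is_zmod_morphism : zmod_morphism artin.
Proof. by move=> x y; rewrite /artin; ring3 tri. Qed.

HB.instance Definition _ :=
  GRing.isZmodMorphism.Build F F artin artin_is_zmod_morphism.

Lemma neg1_neq1 : -1 != 1 :> F.
Proof. exact: oppr_neq3 (oner_neq0 F). Qed.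

Lemma card_cube_roots_unity : #|[set 0; 1; -1 : F]| = 3%N.
Proof.
rewrite setUC cardsU1 cards2 !inE oppr_eq0 oner_eq0 (negPf neg1_neq1).
by rewrite eq_sym oner_eq0.
Qed.

Lemma card_artin_ker : #|[set x | artin x == 0]| = 3%N.
Proof.
rewrite -card_cube_roots_unity; apply: eq_card => x; rewrite !inE /artin.
have -> : x ^+ 3 - x = x * ((x - 1) * (x + 1)) by ring.
by rewrite !mulf_eq0 subr_eq0 addr_eq0 orbA.
Qed.

Lemma trace3_image : trace @: setT = [set 0; 1; -1].
Proof.
apply/setP=> y; apply/imsetP/idP=> [[x _ ->]|].
  by rewrite !inE; case: (trace3_prime x) => ->; rewrite eqxx ?orbT.
have [x nz] := trace3_neq0.
have tN z : trace (- z) = - trace z by rewrite raddfN.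
rewrite !inE -orbA => /or3P[] /eqP ->; first by exists 0; rewrite ?raddf0.
  case: (trace3_prime x) nz => e; rewrite e ?eqxx // => _; first by exists x.
  by exists (- x); rewrite // tN e opprK.
case: (trace3_prime x) nz => e; rewrite e ?eqxx // => _; last by exists x.
by exists (- x); rewrite // tN e.
Qed.

Lemma card_trace3_ker : (#|[set x | trace x == 0%R]| * 3)%N = #|F|.
Proof.
rewrite -card_cube_roots_unity -trace3_image mulnC.
exact/esym/(card_additive trace).
Qed.

(** Additive Hilbert 90. The inclusion is [trace3_cube], and both sides have q/3 elements because
    the two additive maps have a kernel, respectively an image, of size 3. *)
Lemma artin_image : artin @: setT = [set x | trace x == 0].
Proof.
apply/eqP; rewrite eqEcard; apply/andP; split.
  apply/subsetP=> _ /imsetP[x _ ->]; rewrite inE raddfB /=.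
  by rewrite trace3_cube subrr.
by rewrite -(leq_pmul2r (isT : (0 < 3)%N)) card_trace3_ker (card_additive artin)
  card_artin_ker.
Qed.

Lemma card_artin_fiber y :
  #|[set x | artin x == y]| = (if trace y == 0%R then 3 else 0)%N.
Proof.
case: ifPn => [ty|ty].
  have : y \in artin @: setT by rewrite artin_image inE.
  by case/imsetP=> x _ ->; rewrite card_additive_fiber card_artin_ker.
apply/eqP; rewrite cards_eq0; apply/eqP/setP=> x; rewrite !inE.
apply: contraNF ty => /eqP <-; have : artin x \in artin @: setT by rewrite imset_f.
by rewrite artin_image inE.
Qed.

Lemma num_roots_sqr w : w != 0 ->
  num_roots (w ^+ 2) = (if trace w^-1 == 0%R then 3 else 0)%N.
Proof.
move=> w0; have -> : (trace w^-1 == 0) = (trace (- w^-1) == 0).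
  by rewrite raddfN oppr_eq0.
rewrite -card_artin_fiber /num_roots -[RHS](card_imset _ (mulIf w0)).
apply: eq_card => T; rewrite inE; apply/idP/imsetP => [|[M]]; last first.
  rewrite inE => /eqP e ->; apply/eqP.
  have -> : fcubic (w ^+ 2) (M * w) = w ^+ 3 * artin M + w ^+ 2.
    by rewrite /fcubic /artin; ring.
  by rewrite e; field.
move=> /eqP e; exists (T / w); last by rewrite divfK.
rewrite inE; apply/eqP; apply: subr0_eq.
have -> : artin (T / w) - - w^-1 = fcubic (w ^+ 2) T / w ^+ 3.
  by rewrite /fcubic /artin; field.
by rewrite e mul0r.
Qed.

(** T^3 - r T is additive in T, and a nonzero T in its kernel would satisfy T^2 = r; so it is a
    bijection of [F]. *)
Lemma num_roots_nonsquare r : r \in J2 F -> num_roots r = 1%N.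
Proof.
rewrite inE => /andP[r0 /existsPn nsq].
pose g T := T ^+ 3 - r * T.
have g_inj : injective g.
  move=> S T e.
  have : (S - T) * ((S - T) ^+ 2 - r) = 0.
    have -> : (S - T) * ((S - T) ^+ 2 - r) = g S - g T by rewrite /g; ring3 tri.
    by rewrite e subrr.
  by move/eqP; rewrite mulf_eq0 !subr_eq0 (negPf (nsq _)) orbF => /eqP.
have [g' gK g'K] := injF_bij g_inj.
rewrite /num_roots -(cards1 (g' (- r))); apply: eq_card => T.
by rewrite !inE -[RHS](inj_eq g_inj) g'K -addr_eq0.
Qed.

Lemma num_roots_J i r : r \in J char3 i -> (1 + num_roots r)%N = i.
Proof.
case: i => [|[|[|[|[|i]]]]]; rewrite /J ?inE //.
- move=> /andP[r0 /existsP[w /andP[/eqP e t]]]; rewrite -e num_roots_sqr ?(negPf t) //.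
  by apply: contraNneq r0 => w0; rewrite -e w0 expr0n.
- by move=> rJ; rewrite num_roots_nonsquare // inE.
- move=> /andP[r0 /existsP[w /andP[/eqP e t]]]; rewrite -e num_roots_sqr ?t //.
  by apply: contraNneq r0 => w0; rewrite -e w0 expr0n.
Qed.

Lemma J_cover r : r != 0 -> exists2 i, i \in [:: 1; 2; 4]%N & r \in J char3 i.
Proof.
move=> r0; have [/existsP[w e]|ns] := boolP [exists w, w ^+ 2 == r]; last first.
  by exists 2%N => //; rewrite inE r0.
have [t|t] := boolP (trace w^-1 == 0); [exists 4%N | exists 1%N] => //;
  by rewrite inE r0; apply/existsP; exists w; rewrite e.
Qed.

Lemma J_neq0 i r : r \in J char3 i -> r != 0.
Proof. by case: i => [|[|[|[|[|i]]]]]; rewrite /J ?inE // => /andP[]. Qed.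

(** On such a set squaring is exactly two-to-one, since w <> -w. *)
Lemma card_squares (A : {set F}) : (forall w, w \in A -> w != 0 /\ - w \in A) ->
  #|A| = (#|[set (w ^+ 2)%R | w in A]| * 2)%N.
Proof.
move=> hA; apply: card_fibers => w wA; have [w0 nwA] := hA w wA.
have -> : [set y in A | y ^+ 2 == w ^+ 2] = [set w; - w].
  apply/setP=> y; rewrite !inE eqf_sqr andb_idl // => /orP[] /eqP -> //.
by rewrite cards2 eq_sym oppr_neq3.
Qed.

(** Inversion turns the square roots w of elements of J_4 into the nonzero elements of the trace
    kernel. *)
Lemma card_J4 : (#|J4 char3| * 2)%N = (#|F| %/ 3).-1.
Proof.
rewrite -card_trace3_ker mulnK //.
rewrite [in RHS](cardsD1 0) [0 \in _]inE raddf0 eqxx /= -[RHS](card_imset _ (@invr_inj F)).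
have -> : [set x^-1 | x in [set x | trace x == 0] :\ 0] =
    [set w | (w != 0) && (trace w^-1 == 0)].
  apply/setP=> w; apply/imsetP/idP=> [[x]|]; rewrite !inE.
    by move=> /andP[x0 tx] ->; rewrite invr_eq0 x0 invrK.
  by move=> /andP[w0 tw]; exists w^-1; rewrite ?invrK // !inE invr_eq0 w0.
rewrite [RHS]card_squares; last first.
  by move=> w; rewrite !inE oppr_eq0 invrN raddfN oppr_eq0 => /andP[-> ->].
congr (#|pred_of_set _| * 2)%N; apply/setP=> r; rewrite inE.
apply/andP/imsetP=> [[r0 /existsP[w /andP[/eqP e t]]] | [w]].
  exists w => //; rewrite inE t andbT.
  by apply: contraNneq r0 => w0; rewrite -e w0 expr0n.
rewrite inE => /andP[w0 t] ->; rewrite expf_neq0 //; split=> //.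
by apply/existsP; exists w; rewrite eqxx.
Qed.

(** After inversion the square roots w are the 2q/3 elements outside the trace kernel; w = 0 is
    excluded by itself because [0^-1] is 0. *)
Lemma card_J1 : #|J1 char3| = (#|F| %/ 3)%N.
Proof.
apply/eqP; rewrite -(eqn_pmul2r (isT : (0 < 2)%N)); apply/eqP.
have <- : #|[set w | trace w^-1 != 0]| = (#|F| %/ 3 * 2)%N.
  have -> : [set w | trace w^-1 != 0] = ~: [set x^-1 | x in [set x | trace x == 0]].
    apply/setP=> w; rewrite !inE; congr (~~ _).
    by rewrite -[w in RHS]invrK (mem_imset _ _ (@invr_inj F)) inE.
  rewrite cardsCs setCK card_imset; last exact: invr_inj.
  by rewrite -card_trace3_ker mulnK // -[X in (_ * _ - X)%N]muln1 -mulnBr.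
rewrite [RHS]card_squares; last first.
  move=> w; rewrite !inE invrN raddfN oppr_eq0 => t; split=> //.
  by apply: contraNneq t => ->; rewrite invr0 raddf0.
congr (#|pred_of_set _| * 2)%N; apply/setP=> r; rewrite inE.
apply/andP/imsetP=> [[r0 /existsP[w /andP[/eqP e t]]] | [w]].
  by exists w; rewrite // inE.
rewrite inE => t ->; rewrite expf_neq0; last first.
  by apply: contraNneq t => ->; rewrite invr0 raddf0.
by split=> //; apply/existsP; exists w; rewrite eqxx.
Qed.

Lemma card_J2 : (#|J2 F| * 2)%N = #|F|.-1.
Proof.
have nz : (#|[set (w ^+ 2)%R | w in [set~ 0%R : F]]| * 2)%N = #|F|.-1.
  rewrite -card_squares ?cardsC1 // => w; rewrite !inE oppr_eq0; by [].
have -> : J2 F = [set~ 0] :\: [set w ^+ 2 | w in [set~ 0 : F]].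
  apply/setP=> r; rewrite !inE andbC.
  have [-> | r0] := eqVneq r 0; rewrite ?andbF //= !andbT.
  congr (~~ _); apply/existsP/imsetP=> [[w /eqP e] | [w _ ->]]; last by exists w.
  exists w => //; rewrite !inE; apply: contraNneq r0 => w0.
  by rewrite -e w0 expr0n.
rewrite cardsD (setIidPr _) ?cardsC1; last first.
  by apply/subsetP=> _ /imsetP[w wA ->]; move: wA; rewrite !inE => w0; rewrite expf_neq0.
by rewrite mulnBl nz -[X in (_ - X)%N]muln1 -mulnBr muln1.
Qed.

End TraceKernel.

(** * Number of quadruples with a given nonzero discriminant *)

Section DeltaFibers.
Variable F : finFieldType.
Hypothesis tri : 3%:R = 0 :> F.

Lemma translateN b (z : F * F * F * F) : translate (- b) (translate b z) = z.
Proof.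
case: z => [[[z0 z1] z3] z4] /=.
by congr (_, _, _, _); [ring | ring | ring3 tri].
Qed.

(** For z_0 = 0 the discriminant is z_1^2 (z_3^2 - z_1 z_3^3 - z_4), so z_1 <> 0 and z_3 are free
    and determine z_4. *)
Lemma card_delta_fiber0 (c : F) : c != 0 ->
  #|[set z : F * F * F * F | (z.1.1.1 == 0) && (deltaq z == c)]|
    = (#|F|.-1 * #|F|)%N.
Proof.
move=> c0; pose f (p : F * F) : F * F * F * F :=
  (0, p.1, p.2, p.2 ^+ 2 - p.1 * p.2 ^+ 3 - c / p.1 ^+ 2).
rewrite -(cardsC1 (0 : F)) -cardsT -cardsX -(card_imset (f := f)); last first.
  by move=> [z1 z3] [y1 y3] [-> ->].
apply: eq_card => -[[[z0 z1] z3] z4]; rewrite inE /= /delta.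
apply/andP/imsetP => [[/eqP -> /eqP e] | [[y1 y3]]].
  have {}e : z1 ^+ 2 * (z3 ^+ 2 - z1 * z3 ^+ 3 - z4) = c by rewrite -e; ring.
  have z10 : z1 != 0 by apply: contraNneq c0 => z10; rewrite -e z10; apply/eqP; ring.
  exists (z1, z3); first by rewrite !inE z10.
  by rewrite /f /= -e; congr (_, _, _, _); field.
rewrite !inE andbT /= => y10 [-> -> -> ->]; split=> //.
by apply/eqP; field.
Qed.

(** A translation brings z_1 to 0 and leaves u (u - 1)^2 - z_0 z_3^2 = c. For each u there are q - 1
    pairs (z_0, z_3): if u (u - 1)^2 = c then z_3 = 0 and z_0 is free, otherwise z_3 <> 0 is free
    and determines z_0. In [h], k is this free coordinate; b records the translation. *)
Lemma card_delta_fiber1 (c : F) : c != 0 ->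
  #|[set z : F * F * F * F | (z.1.1.1 != 0) && (deltaq z == c)]|
    = (#|F| * #|F| * #|F|.-1)%N.
Proof.
move=> c0; pose g (u : F) := u * (u - 1) ^+ 2.
pose h (u k : F) : F * F := if g u == c then (k, 0) else ((g u - c) / k ^+ 2, k).
have hP u k : k != 0 -> (h u k).1 != 0 /\ g u - (h u k).1 * (h u k).2 ^+ 2 = c.
  move=> k0; rewrite /h; case: (g u =P c) => [->|/eqP ne] /=.
    by split=> //; ring.
  split; last by field.
  by rewrite mulf_neq0 ?invr_eq0 ?expf_neq0 // subr_eq0.
pose f (p : F * F * F) := let: (b, u, k) := p in
  translate b ((h u k).1, 0, (h u k).2, u / (h u k).1).
rewrite -(cardsC1 (0 : F)) -!cardsT -!cardsX -(card_in_imset (f := f)); last first.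
  move=> [[b u] k] [[b' u'] k']; rewrite !inE /= => k0 k0'.
  have [h0 _] := hP u k k0; have [h0' _] := hP u' k' k0'.
  case=> e1 e2 e3 e4.
  have eb : b = b'.
    apply: (mulIf h0'); apply: oppr_inj; rewrite -[LHS]add0r -[RHS]add0r -e2.
    by rewrite e1.
  move: e3; rewrite e1 eb => /addIr/addIr e3.
  move: e4; rewrite eb e1 e3 => /addIr/addIr/addIr/(mulIf _)-/(_ (invr_neq0 h0')) eu.
  move: e1 e3; rewrite eu /h; case: (g u' =P c) => _ /=; first by move=> ->.
  by move=> _ ->.
apply: eq_card => z; rewrite inE; apply/andP/imsetP => [[z0 /eqP dz] | [[[b u] k]]].
  have [z0' [z3 [z4 [zE z00]]]] : exists z0' z3 z4 : F,
      translate (z.1.1.1^-1 * z.1.1.2) z = (z0', 0, z3, z4) /\ z0' != 0.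
    case: z z0 {dz} => [[[z0 z1] z3] z4] /= z00; do 3!eexists; split; last exact: z00.
    by congr (_, _, _, _); field.
  have dE : g (z0' * z4) - z0' * z3 ^+ 2 = c.
    by rewrite -(deltaqE tri) -zE deltaq_translate.
  pose k := if g (z0' * z4) == c then z0' else z3.
  have hE : h (z0' * z4) k = (z0', z3).
    rewrite /h /k; case: (g (z0' * z4) =P c) => [e|/eqP ne].
      have /eqP : z0' * z3 ^+ 2 = 0.
        have -> : z0' * z3 ^+ 2 = g (z0' * z4) - (g (z0' * z4) - z0' * z3 ^+ 2) by ring.
        by rewrite dE e subrr.
      by rewrite mulf_eq0 (negPf z00) expf_eq0 => /eqP ->.
    have z30 : z3 != 0.
      by apply: contraNneq ne => z30; rewrite -dE z30 expr0n mulr0 subr0.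
    by congr (_, _); rewrite -[X in _ - X]dE; field.
  exists (- (z.1.1.1^-1 * z.1.1.2), z0' * z4, k).
    rewrite !inE /= /k; case: (g (z0' * z4) =P c) => [//|/eqP ne].
    by apply: contraNneq ne => z30; rewrite -dE z30 expr0n mulr0 subr0.
  by rewrite /f hE /= -[LHS](translateN (z.1.1.1^-1 * z.1.1.2)) zE [z0' * z4]mulrC mulfK.
rewrite !inE /= => k0 ->; have [h0 e] := hP u k k0; split=> //.
rewrite -/(translate b (_, 0, _, _)) deltaq_translate // (deltaqE tri).
have -> : (h u k).1 * (u / (h u k).1) = u by rewrite mulrCA mulfV // mulr1.
exact/eqP.
Qed.

Lemma card_delta_fiber (c : F) : c != 0 ->
  #|[set z : F * F * F * F | deltaq z == c]| = #|PGL2 F|.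
Proof.
move=> c0; rewrite card_PGL2 -(cardsID [set z | z.1.1.1 == 0]).
rewrite (_ : _ :&: _ = [set z | (z.1.1.1 == 0) && (deltaq z == c)]); last first.
  by apply/setP=> z; rewrite !inE andbC.
rewrite (_ : _ :\: _ = [set z | (z.1.1.1 != 0) && (deltaq z == c)]); last first.
  by apply/setP=> z; rewrite !inE.
by rewrite card_delta_fiber0 // card_delta_fiber1 //; ring.
Qed.

End DeltaFibers.

(** * Number of orbits with prescribed invariants *)

Section OrbitCount.
Variable F : finFieldType.
Hypothesis tri : 3%:R = 0 :> F.
Implicit Types R : {set F}.

(* As 0^-1 = 0, these lines have nonzero discriminant as soon as 0 is not in R. *)
Definition lines_jinv R : {set {set 'cV[F]_4}} :=
  [set graph z | z in [set z | (deltaq z)^-1 \in R]].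

Lemma lines_jinvP R L : 0 \notin R ->
  reflect (exists z, [/\ deltaq z != 0, (deltaq z)^-1 \in R & L = graph z])
          (L \in lines_jinv R).
Proof.
move=> R0; apply: (iffP imsetP) => [[z] | [z [D0 zR ->]]].
  rewrite inE => zR ->; exists z; split=> //.
  by apply: contraNneq R0 => D0; rewrite -invr0 -D0.
by exists z; rewrite ?inE.
Qed.

Lemma PGL2_gt0 : (0 < #|PGL2 F|)%N. Proof. exact: cardG_gt0. Qed.

Lemma card_lines_jinv R : 0 \notin R -> #|lines_jinv R| = (#|R| * #|PGL2 F|)%N.
Proof.
move=> R0; rewrite card_imset; last exact: graph_inj.
rewrite -sum1_card (partition_big (fun z : F * F * F * F => (deltaq z)^-1) (mem R)) /=; last first.
  by move=> z; rewrite inE.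
rewrite -sum_nat_const; apply: eq_bigr => r rR.
have r0 : r^-1 != 0 by rewrite invr_eq0; apply: contraNneq R0 => <-.
rewrite sum1dep_card -(card_delta_fiber tri r0); apply: eq_card => z.
rewrite !inE (can2_eq (@invrK F) (@invrK F)) andb_idl // => /eqP ->.
by rewrite invrK.
Qed.

Lemma acts_lines_jinv R : 0 \notin R ->
  [acts 'GL_2[F]%g, on lines_jinv R | GL_action tri].
Proof.
move=> R0.
have sub g L : L \in lines_jinv R -> GL_action tri L g \in lines_jinv R.
  case/imsetP=> z; rewrite inE => zR ->.
  have [z' e dE] := preserves_delta_unit tri (GLval_unit g^-1%g) z.
  by rewrite GL_actE e imset_f // inE dE.
apply/actsP=> g _ L; apply/idP/idP=> [|/sub]; last exact.
by move/(sub g^-1%g); rewrite actK.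
Qed.

Lemma partition_lines_jinv R : 0 \notin R ->
  partition [set line_orbit L | L in lines_jinv R] (lines_jinv R).
Proof.
move=> R0; rewrite (eq_in_imset (g := orbit (GL_action tri) 'GL_2[F]%g)).
  exact/orbit_partition/acts_lines_jinv.
by move=> _ /imsetP[z _ ->]; rewrite line_orbitE // is_line_graph.
Qed.

(** The |R| |G| lines are partitioned into orbits of |G|/i lines each. *)
Lemma card_orbits_jinv i R : 0 \notin R -> {in R, forall r, (1 + num_roots r)%N = i} ->
  #|[set line_orbit L | L in lines_jinv R]| = (i * #|R|)%N.
Proof.
move=> R0 hR; apply/eqP; rewrite -(eqn_pmul2r PGL2_gt0); apply/eqP.
rewrite -mulnA -card_lines_jinv // (card_partition (partition_lines_jinv R0)).
rewrite big_distrr -sum_nat_const; apply: eq_bigr => _ /imsetP[_ /lines_jinvP-/(_ R0)[z [D0 zR ->]] ->].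
by rewrite -(card_line_orbit tri D0) (hR _ zR) mulnC.
Qed.

Variables (K : closedFieldType) (FtoK : {rmorphism F -> K}).

Lemma generic_orbits_jinvE r : r != 0 ->
  generic_orbits_jinv FtoK r = [set line_orbit L | L in lines_jinv [set r]].
Proof.
move=> r0; have R0 : 0 \notin [set r] by rewrite inE eq_sym.
apply/setP=> O; apply/imsetP/imsetP => [[L] | [_ /lines_jinvP-/(_ R0)[z [D0 zr ->]] ->]].
  rewrite inE => /andP[/(generic_linesP FtoK tri)[z D0 ->]].
  rewrite has_jinv_graph D0 /= => zr ->; exists (graph z) => //.
  by apply/(lines_jinvP _ R0); exists z; rewrite inE.
exists (graph z) => //; rewrite inE has_jinv_graph D0 /=; apply/andP; split.
  by apply/(generic_linesP FtoK tri); exists z.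
by rewrite inE in zr.
Qed.

Lemma generic_orbitsP O :
  reflect (exists2 z, deltaq z != 0 & O = line_orbit (graph z))
          (O \in generic_orbits FtoK).
Proof.
apply: (iffP imsetP) => [[_ /(generic_linesP FtoK tri)[z D0 ->] ->] | [z D0 ->]].
  by exists z.
by exists (graph z) => //; apply/(generic_linesP FtoK tri); exists z.
Qed.

End OrbitCount.

(** * Orbits sorted by size *)

Section SizeClasses.
Variables (F : finFieldType) (char3 : 3%N \in [pchar F]).
Variables (K : closedFieldType) (FtoK : {rmorphism F -> K}).
Let tri : 3%:R = 0 :> F := pcharf0 char3.

Lemma J_notin0 i : 0 \notin J char3 i.
Proof. by apply/negP=> /J_neq0/eqP. Qed.

(** The size of an orbit determines 1 + [num_roots] of its invariant, which is the index of the
    class containing that invariant. For i outside {1, 2, 4} both sides are empty. *)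
Lemma orbits_of_size i :
  [set O in generic_orbits FtoK | #|O| * i == #|PGL2 F|]%N =
  [set line_orbit L | L in lines_jinv (J char3 i)].
Proof.
apply/setP=> O; rewrite inE; apply/andP/imsetP => [[] | [L]].
  case/(generic_orbitsP tri)=> z D0 ->; rewrite -(card_line_orbit tri D0).
  have O0 : (0 < #|line_orbit (graph z)|)%N.
    move: (PGL2_gt0 F); rewrite -(card_line_orbit tri D0) muln_gt0.
    by case/andP.
  rewrite eqn_pmul2l // => /eqP iE; exists (graph z) => //.
  apply/lines_jinvP; first exact: J_notin0.
  exists z; split=> //.
  have [|j _ zj] := @J_cover _ char3 (deltaq z)^-1; first by rewrite invr_eq0.
  by rewrite iE (num_roots_J zj).
case/(lines_jinvP _ (J_notin0 i))=> z [D0 zi ->] ->; split.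
  by apply/(generic_orbitsP tri); exists z.
by rewrite -(card_line_orbit tri D0) (num_roots_J zi).
Qed.

Lemma card_orbits_of_size i :
  #|[set O in generic_orbits FtoK | #|O| * i == #|PGL2 F|]|%N = (i * #|J char3 i|)%N.
Proof.
rewrite orbits_of_size; apply: (card_orbits_jinv tri (J_notin0 i)) => r.
exact: num_roots_J.
Qed.

Lemma card_generic_orbits :
  #|generic_orbits FtoK| = (#|J char3 1| + 2 * #|J char3 2| + 4 * #|J char3 4|)%N.
Proof.
pose S i := [set O in generic_orbits FtoK | #|O| * i == #|PGL2 F|]%N.
have Sdisj i j O : O \in S i -> O \in S j -> i = j.
  rewrite !inE => /andP[_ /eqP e] /andP[_ /eqP e'].
  have O0 : (0 < #|O|)%N by move: (PGL2_gt0 F); rewrite -e muln_gt0 => /andP[].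
  by apply/eqP; rewrite -(eqn_pmul2l O0) e e'.
have -> : generic_orbits FtoK = (S 1%N :|: S 2%N) :|: S 4%N.
  apply/setP=> O; rewrite !inE -!andb_orr andb_idr // => OG.
  have /(generic_orbitsP tri)[z D0 OE] := OG; rewrite OE -(card_line_orbit tri D0).
  have [|j j124 zj] := @J_cover _ char3 (deltaq z)^-1; first by rewrite invr_eq0.
  rewrite (num_roots_J zj); move: j124; rewrite !inE.
  by case/or3P=> /eqP ->; rewrite eqxx ?orbT.
rewrite !cardsU !card_orbits_of_size mul1n.
rewrite (_ : (S 1%N :|: S 2%N) :&: S 4%N = set0); last first.
  apply/setP=> O; rewrite [RHS]inE; apply/negP=> /setIP[/setUP[] /Sdisj h /h].
    by [].
  by [].
rewrite (_ : S 1%N :&: S 2%N = set0) ?cards0 ?subn0 //.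
by apply/setP=> O; rewrite [RHS]inE; apply/negP=> /setIP[/Sdisj h /h].
Qed.

End SizeClasses.

Theorem theorem1p6 (q n : nat) (F : finFieldType)
    (q_pow3 : q = (3 ^ n)%N) (cardF : #|F| = q)
    (K : closedFieldType) (FtoK : {rmorphism F -> K})
    (K_alg : integralRange FtoK) :
  [/\ forall (i : nat) (r : F), i \in [:: 1; 2; 4]%N ->
        r \in J (pchar3 q_pow3 cardF) i ->
        #|generic_orbits_jinv FtoK r| = i
        /\ (forall O, O \in generic_orbits_jinv FtoK r ->
              (#|O| * i)%N = #|PGL2 F|),
      forall O, O \in generic_orbits FtoK ->
        exists (i : nat) (r : F),
          [/\ i \in [:: 1; 2; 4]%N, r \in J (pchar3 q_pow3 cardF) i
            & O \in generic_orbits_jinv FtoK r],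
      #|generic_orbits FtoK| = (2 * q - 3)%N
    & [/\ #|[set O in generic_orbits FtoK | #|O| == #|PGL2 F|]| = (q %/ 3)%N,
          #|[set O in generic_orbits FtoK | #|O| * 2 == #|PGL2 F|]|%N = (q - 1)%N
        & #|[set O in generic_orbits FtoK | #|O| * 4 == #|PGL2 F|]|%N
            = ((2 * q - 6) %/ 3)%N]].
Proof.
set char3 := pchar3 q_pow3 cardF.
have tri : 3%:R = 0 :> F := pcharf0 char3.
have F1 : (1 < q)%N by rewrite -cardF finNzRing_gt1.
have q3 : q = (q %/ 3 * 3)%N by rewrite -cardF -(card_trace3_ker char3) mulnK.
have j1 : #|J char3 1| = (q %/ 3)%N by rewrite -cardF; exact: card_J1.
have j2 : (#|J char3 2| * 2)%N = q.-1 by rewrite -cardF; exact: card_J2.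
have j4 : (#|J char3 4| * 2)%N = (q %/ 3).-1 by rewrite -cardF; exact: card_J4.
split.
- move=> i r _ rJ; have r0 := J_neq0 rJ; rewrite generic_orbits_jinvE //.
  have R0 : 0 \notin [set r] by rewrite inE eq_sym.
  split=> [|_ /imsetP[_ /lines_jinvP-/(_ R0)[z [D0 /set1P zr ->]] ->]].
    rewrite (card_orbits_jinv (i := i) tri R0) ?cards1 ?muln1 // => _ /set1P->.
    exact: num_roots_J.
  by rewrite -(num_roots_J rJ) -zr card_line_orbit.
- move=> O /(generic_orbitsP tri)[z D0 ->].
  have r0 : (deltaq z)^-1 != 0 by rewrite invr_eq0.
  have [i i124 zi] := J_cover char3 r0.
  exists i, (deltaq z)^-1; split=> //; rewrite generic_orbits_jinvE //.
  apply: imset_f; apply/lines_jinvP; first by rewrite inE eq_sym.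
  by exists z; rewrite inE.
(* The sum is q/3 + (q - 1) + 2 (q/3 - 1); the truncated subtractions and the division are exact
   because q > 1 is a multiple of 3. *)
- rewrite (card_generic_orbits char3); lia.
split; last 2 first.
- by rewrite (card_orbits_of_size char3); lia.
- by rewrite (card_orbits_of_size char3); lia.
rewrite -j1 -[RHS]mul1n -(card_orbits_of_size char3 FtoK).
by apply: eq_card => O; rewrite !inE muln1.
Qed.
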